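(* A graph $H$ is a planar partial cube if and only if $H$ arises from the single-vertex graph $K_1$ by a (finite, possibly empty) sequence of non-crossing 2-face expansions; that is, if and only if there are $\ell\ge 0$ and graphs $H_0,H_1,\dots,H_\ell$ with $H_0\cong K_1$, $H_\ell\cong H$, such that for every $1\le i\le \ell$ the graph $H_{i}$ is a non-crossing 2-face expansion of $H_{i-1}$.
   Context: Graphs are simple, finite and non-empty. The hypercube graph $Q_d$ has vertex set $\{0,1\}^d$, with two vertices adjacent iff they differ in exactly one coordinate. A subgraph $G$ of a graph $K$ is isometric if $\mathrm{dist}_G(v,w)=\mathrm{dist}_K(v,w)$ for all vertices $v,w$ of $G$. A graph is a partial cube if it is isomorphic to an isometric subgraph of some hypercube graph $Q_d$ (with $d \geq 0$ finite). Expansion: Let $G^1$ and $G^2$ be two isometric subgraphs of a graph $G$ that edge-cover $G$ (every vertex and every edge of $G$ lies in $G^1$ or in $G^2$) and whose intersection $G':=G^1\cap G^2$ is non-empty. The expansion $H$ of $G$ with respect to $G^1$ and $G^2$ is the graph obtained by taking disjoint copies of $G^1$ and $G^2$ and, for every vertex $v$ of $G'$, adding an edge between the copy of $v$ in $G^1$ and the copy of $v$ in $G^2$. We say that $H$ is an expansion of $G$ if it is (isomorphic to) the expansion of $G$ with respect to some such $G^1,G^2$. Non-crossing 2-face expansion: An expansion $H$ of a planar graph $G$ with respect to $G^1$ and $G^2$ is a non-crossing 2-face expansion of $G$ if $G^1$ and $G^2$ have (separate) plane embeddings such that $G'=G^1\cap G^2$ lies on the outer face in both of the respective embeddings (i.e.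 every vertex of $G'$ is incident with the outer face), and such that the orderings on (the vertices of) $G'$ obtained from traversing the outer faces of $G^1$ and $G^2$ in clockwise order, respectively, are opposite. Here orderings are understood as cyclic orderings; if a vertex of $G'$ occurs several times on the boundary walk of an outer face, one occurrence of it on that walk is selected, and the condition requires that the selections can be made so that the two resulting cyclic orderings are reverse to each other. *)

(* Defs.v *)
From HB Require Import structures.
From mathcomp Require Import all_boot perm.

Set Implicit Arguments.
Unset Strict Implicit.
Unset Printing Implicit Defensive.

Record graph := Graph {
  vertex :> finType;
  adj : rel vertex;
  adj_sym : symmetric adj;
  adj_irr : irreflexive adj;
  vertex_gt0 : 0 < #|vertex| }.

Arguments adj {g}.

Definition iso (G H : graph) : Prop :=
  exists f : G -> H, bijective f /\ forall x y, adj (f x) (f y) = adj x y.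

Definition walk (G : graph) (x y : G) (n : nat) : bool :=
  [exists p : n.-tuple G, path adj x p && (last x p == y)].

Lemma connect_walk (G : graph) (x y : G) :
  connect adj x y -> exists n, walk x y n.
Proof.
case/connectP=> p xp ->; exists (size p).
by apply/existsP; exists (in_tuple p); rewrite xp eqxx.
Qed.

(* [None] is the infinite distance. *)
Definition dist (G : graph) (x y : G) : option nat :=
  if decP (@idP (connect adj x y)) is left xy
  then Some (ex_minn (connect_walk xy)) else None.

(* Subgraphs need not be induced. *)
Record subgraph (K : graph) := Subgraph {
  sv : {set K};
  se : rel K;
  se_sym : symmetric se;
  se_sub : forall x y, se x y -> [&& x \in sv, y \in sv & adj x y];
  sv_neq0 : sv != set0 }.

Section GraphOfSubgraph.
Variables (K : graph) (S : subgraph K).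

Definition sg_adj : rel {x : K | x \in sv S} :=
  fun x y => se S (val x) (val y).

Lemma sg_adj_sym : symmetric sg_adj.
Proof. by move=> x y; apply: se_sym. Qed.

Lemma sg_adj_irr : irreflexive sg_adj.
Proof.
by move=> x; apply/negP=> /se_sub /and3P[_ _]; rewrite adj_irr.
Qed.

Lemma sg_gt0 : 0 < #|{: {x : K | x \in sv S}}|.
Proof. by rewrite card_sig card_gt0 sv_neq0. Qed.

Definition graph_of : graph := Graph sg_adj_sym sg_adj_irr sg_gt0.

Definition isometric : Prop :=
  forall x y : graph_of, dist x y = dist (val x : K) (val y : K).

End GraphOfSubgraph.

Definition cube_adj (d : nat) : rel {ffun 'I_d -> bool} :=
  fun x y => #|[set i | x i != y i]| == 1.

Lemma cube_adj_sym d : symmetric (@cube_adj d).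
Proof.
move=> x y; rewrite /cube_adj; congr (_ == _).
by apply: eq_card => i; rewrite !inE eq_sym.
Qed.

Lemma cube_adj_irr d : irreflexive (@cube_adj d).
Proof.
by move=> x; rewrite /cube_adj eq_card0 // => i; rewrite !inE eqxx.
Qed.

Lemma cube_gt0 d : 0 < #|{: {ffun 'I_d -> bool}}|.
Proof. by apply/card_gt0P; exists [ffun=> false]. Qed.

Definition hypercube (d : nat) : graph :=
  Graph (@cube_adj_sym d) (@cube_adj_irr d) (cube_gt0 d).

Definition partial_cube (G : graph) : Prop :=
  exists (d : nat) (S : subgraph (hypercube d)),
    isometric S /\ iso G (graph_of S).

Lemma K1_sym : symmetric (fun _ _ : unit => false). Proof. by []. Qed.
Lemma K1_irr : irreflexive (fun _ _ : unit => false). Proof. by []. Qed.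
Lemma K1_gt0 : 0 < #|{: unit}|. Proof. by rewrite card_unit. Qed.

Definition K1 : graph := Graph K1_sym K1_irr K1_gt0.

Definition edge_cover (G : graph) (G1 G2 : subgraph G) : Prop :=
  (forall x : G, (x \in sv G1) || (x \in sv G2)) /\
  (forall x y : G, adj x y -> se G1 x y || se G2 x y).

Section Expansion.
Variables (G : graph) (G1 G2 : subgraph G).

Definition exp_adj : rel (graph_of G1 + graph_of G2)%type := fun u v =>
  match u, v with
  | inl x, inl y => adj x y
  | inr x, inr y => adj x y
  | inl x, inr y | inr y, inl x => val x == val y
  end.

Lemma exp_adj_sym : symmetric exp_adj.
Proof. by move=> [x|x] [y|y] //=; apply: sg_adj_sym. Qed.

Lemma exp_adj_irr : irreflexive exp_adj.
Proof. by move=> [x|x] /=; apply: sg_adj_irr. Qed.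

Lemma exp_gt0 : 0 < #|{: graph_of G1 + graph_of G2}|.
Proof. by rewrite card_sum addn_gt0 vertex_gt0. Qed.

Definition expansion_graph : graph := Graph exp_adj_sym exp_adj_irr exp_gt0.

Definition expansion_wrt (H : graph) : Prop :=
  [/\ isometric G1, isometric G2, edge_cover G1 G2,
      sv G1 :&: sv G2 != set0 & iso H expansion_graph].

End Expansion.

(* Plane embeddings are combinatorial: an edge consists of two opposite darts *)
(* (oriented edges), and an embedding in an oriented surface is given by the  *)
(* clockwise cyclic order of the darts leaving each vertex.                   *)
Section Embedding.
Variable G : graph.

Definition dart : finType := {p : G * G | adj p.1 p.2}.

Definition source (d : dart) : G := (val d).1.

Lemma dart_rev_subproof (d : dart) : adj (val d).2 (val d).1.
Proof. by rewrite adj_sym; apply: (valP d). Qed.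

Definition dart_rev (d : dart) : dart :=
  exist _ ((val d).2, (val d).1) (dart_rev_subproof d).

Definition rotation_system (r : {perm dart}) : Prop :=
  forall d e : dart, fconnect r d e = (source d == source e).

(* The orbits of [face r] are the facial walks, followed with the face on the *)
(* left; the outer face is thus traversed clockwise.                          *)
Definition face (r : {perm dart}) (d : dart) : dart := r (dart_rev d).

Definition dart_link (r : {perm dart}) : rel dart :=
  fun d e => (e == r d) || (e == dart_rev d).

(* V + F = E + 2C, i.e. every component is embedded in the sphere. Isolated   *)
(* vertices carry no dart and contribute to neither side.                     *)
Definition spherical (r : {perm dart}) : Prop :=
  fcard r dart + fcard (face r) dart
    = fcard dart_rev dart + 2 * n_comp (dart_link r) dart.

Definition planar : Prop :=
  exists r : {perm dart}, rotation_system r /\ spherical r.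

(* The vertices met along a facial walk, with repetitions. The facial walk of *)
(* a one-vertex graph is the trivial walk, which has no dart.                 *)
Definition facial_walk (r : {perm dart}) (w : seq G) : Prop :=
  (exists d : dart, w = [seq source e | e <- orbit (face r) d]) \/
  (exists2 x : G, w = [:: x] & forall y : G, y = x).

(* Plane embeddings with a distinguished outer face are only considered for   *)
(* connected graphs, where the boundary of a face is a single walk.           *)
Record plane_embedding := PlaneEmbedding {
  pe_rot : {perm dart};
  pe_outer : seq G;
  pe_connected : forall x y : G, connect adj x y;
  pe_rotation : rotation_system pe_rot;
  pe_spherical : spherical pe_rot;
  pe_facial : facial_walk pe_rot pe_outer }.

End Embedding.

(* [s] lists [A] in the clockwise cyclic order of the outer face of [E]; the  *)
(* subsequence selects one occurrence of each vertex of [A] on the outer walk.*)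
Definition outer_order (G : graph) (S : subgraph G)
    (E : plane_embedding (graph_of S)) (A : {set G}) (s : seq G) : Prop :=
  [/\ uniq s, s =i A &
      exists k, subseq s (rot k [seq val x | x <- pe_outer E])].

Definition noncrossing (G : graph) (G1 G2 : subgraph G) : Prop :=
  exists (E1 : plane_embedding (graph_of G1))
         (E2 : plane_embedding (graph_of G2)) (s1 s2 : seq G),
    [/\ outer_order E1 (sv G1 :&: sv G2) s1,
        outer_order E2 (sv G1 :&: sv G2) s2 &
        exists k, s2 = rot k (rev s1)].

Definition noncrossing_2face_expansion (G H : graph) : Prop :=
  planar G /\
  exists G1 G2 : subgraph G, expansion_wrt G1 G2 H /\ noncrossing G1 G2.

(* Main.v *)
Require Import Defs.
From mathcomp Require Import all_boot.
From mathcomp Require Import fingroup perm zify.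

Set Implicit Arguments.
Unset Strict Implicit.
Unset Printing Implicit Defensive.

Local Open Scope nat_scope.

(** A plane graph is a pair of permutations of its darts, the reversal [e] and
the rotation [r]; its faces are the cycles of [e * r]. For any two permutations
of a finite set, the numbers of cycles of [e], [r] and [e * r] add up to at most
the number of points plus twice the number of orbits ([euler_le]); planarity is
equality there, called [genus0] below. The proof of the inequality shows that
splitting a cycle of one of the permutations preserves equality
([genus0_split]). This single operation yields the closure properties of
planarity that are needed: cutting edges into half-edges, passing to a submap
([genus0_skip], [submap]) and, by splitting the reversal while the faces are kept
([genus0_dual]), contracting edges.

From a planar partial cube to a sequence of expansions. Label the vertices by
0/1-words at the right Hamming distances and choose a coordinate that takes both
values. The edges along this coordinate match vertices of the two sides, and
both sides are connected, because a geodesic between two vertices of a side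
never leaves it. Contracting these edges gives a smaller planar partial cube of
which the given graph is an expansion ([contract_expansion]), so induction
applies. Why is that expansion non-crossing? Cut the k matching edges in half.
The connected map falls into two components, and equality in Euler's formula
before and after says that, among the faces which meet the cut, there are m
before and m - k + 2 after. Each such face contains half-edges of both sides
before the cut, so m <= k; after it each side has at least one such face, so
m - k + 2 >= 2. Hence m = k and exactly one face on each side meets the cut
([cut_one_face]): it becomes the outer face of that side. As m = k, each face
that met the cut contains exactly two half-edges, one from each side, so that
two cyclically consecutive edges of the cut on one side are consecutive in the
reverse order on the other ([cut_reverse]).

From a sequence of expansions to a planar partial cube. Labels of an expansion
are obtained from those of the original graph by one more letter that tells the
two copies apart ([expansion_cube]). For planarity, insert a half-edge before
each selected occurrence on the two outer walks ([augment]) and join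
corresponding half-edges ([glue_planar]). As the two orders are opposite, the
joining edges lie on as many different faces as there are such edges
([bridge_faces]), and this number of faces makes the Euler count at least what
equality asks for. *)

(** * Components of relations and cycles of permutations *)

(* Counts of components occur in convertible but syntactically different forms; *)
(* generalizing over them one by one identifies these forms before [lia].       *)
Ltac gen_lia :=
  repeat match goal with H : is_true (_ <= _) |- _ => revert H
                       | H : @eq nat _ _ |- _ => revert H end;
  do ?[move: (n_comp_mem _ _) => ?]; lia.

Section Components.
Variables (T : finType) (e : rel T).
Hypothesis sym_e : connect_sym e.

Lemma n_comp_le_cover (a S : {pred T}) :
    (forall x, x \in a -> exists2 y, y \in S & connect e x y) ->
  n_comp e a <= #|S|.
Proof.
move=> cov; rewrite -(size_image (root e) S).
apply: leq_trans (card_size (image (root e) S)); apply/subset_leq_card/subsetP.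
move=> x /andP[/eqP rx /cov[y yS /(rootP sym_e)]]; rewrite rx => ->.
exact: image_f.
Qed.

Lemma n_comp_ge_indep (a S : {pred T}) : closed e a -> {subset S <= a} ->
    {in S &, forall x y, connect e x y -> x = y} -> #|S| <= n_comp e a.
Proof.
move=> cl_a Sa indep.
have inj : {in S &, injective (root e)}.
  by move=> x y xS yS /(rootP sym_e); apply: indep.
rewrite -(card_in_image inj); apply/subset_leq_card/subsetP=> _ /imageP[x xS ->].
by rewrite inE roots_root //= -(closed_connect cl_a (connect_root e x)) Sa.
Qed.

Lemma n_compID (a b : {pred T}) :
  n_comp e a = n_comp e [predI a & b] + n_comp e [predD a & b].
Proof.
rewrite /n_comp_mem -(cardID b); congr (_ + _); apply: eq_card => x /=.
  by rewrite !inE andbA.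
by rewrite !inE andbCA.
Qed.

End Components.

Section Genus.
Variable T : finType.
Implicit Types a b : {perm T}.

Definition glink (a b : T -> T) : rel T := fun x y => (y == a x) || (y == b x).

Lemma fconnect_porbit a x y : fconnect a x y = (y \in porbit a x).
Proof.
apply/idP/porbitP => [/iter_findex <-|[i ->]]; last first.
  by rewrite permX fconnect_iter.
by exists (findex a x y); rewrite permX.
Qed.

Lemma fcard_porbits a : fcard a T = #|porbits a|.
Proof.
have inj : {in predI (froots a) T &, injective (porbit a)}.
  move=> x y /andP[/eqP rx _] /andP[/eqP ry _] /eqP.
  rewrite eq_porbit_mem porbit_sym -fconnect_porbit.
  by move/(rootP (fconnect_sym perm_inj)); rewrite rx ry.
rewrite [LHS](_ : _ = #|porbit a @: predI (froots a) T|); last first.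
  by rewrite card_in_imset.
apply: eq_card => X; apply/imsetP/imsetP => -[x _ ->]; first by exists x.
exists (froot a x); first by rewrite inE (roots_root (fconnect_sym perm_inj)).
by apply/esym/eqP; rewrite eq_porbit_mem -fconnect_porbit connect_root.
Qed.

Lemma fcardV a : fcard a^-1%g T = fcard a T.
Proof. by rewrite !fcard_porbits porbitsV. Qed.

Lemma fcard_mul_tperm a x y : x != y ->
  fcard (a * tperm x y)%g T + (~~ fconnect a x y).*2 = (fcard a T).+1.
Proof.
move=> xy; have := porbits_mul_tperm a^-1 x y.
rewrite xy porbitsV porbitV -(fcard_porbits a) addn1 => <-; congr (_ + _).
  by rewrite -fcardV invMg tpermV fcard_porbits.
by rewrite fconnect_porbit porbit_sym.
Qed.

Lemma glink_sym a b : connect_sym (glink a b).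
Proof.
have subl : subrel (frel a) (connect (glink a b)).
  by move=> x y /= ay; rewrite connect1 // /glink eq_sym ay.
have subr : subrel (frel b) (connect (glink a b)).
  by move=> x y /= ay; rewrite connect1 // /glink [X in _ || X]eq_sym ay orbT.
apply: symmetric_from_pre => x _ /connectP[p xp ->].
elim: p x xp => //= y p IHp x /andP[/orP xy /IHp /connect_trans]; apply.
case: xy => /eqP ->.
  apply: (connect_sub subl); rewrite fconnect_sym ?fconnect1 //; exact: perm_inj.
apply: (connect_sub subr); rewrite fconnect_sym ?fconnect1 //; exact: perm_inj.
Qed.

Lemma glink_r a b x y : fconnect b x y -> connect (glink a b) x y.
Proof.
apply: connect_sub => u v /= /eqP <-; rewrite connect1 //.
by rewrite /glink eqxx orbT.
Qed.

Lemma glink_sub (a b a' b' : {perm T}) :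
    (forall x, connect (glink a' b') x (a x)) ->
    (forall x, connect (glink a' b') x (b x)) ->
  subrel (connect (glink a b)) (connect (glink a' b')).
Proof. by move=> ha hb; apply: connect_sub => x y /orP[/eqP ->|/eqP ->]. Qed.

Lemma eq_glink (a b a' b' : {perm T}) :
    (forall x, connect (glink a' b') x (a x)) ->
    (forall x, connect (glink a' b') x (b x)) ->
    (forall x, connect (glink a b) x (a' x)) ->
    (forall x, connect (glink a b) x (b' x)) ->
  n_comp (glink a b) T = n_comp (glink a' b') T.
Proof.
move=> h1 h2 h3 h4; apply: eq_n_comp => x y.
by apply/idP/idP; apply: glink_sub.
Qed.

(** For [b] the reversal of darts and [a] a rotation, this is
edges + vertices + faces, and [euler_bound] is 2 edges + 2 components, so that
the genus is half of the difference. *)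
Definition euler_count (b a : {perm T}) :=
  fcard b T + fcard a T + fcard (b * a)%g T.
Definition euler_bound (b a : {perm T}) := #|T| + 2 * n_comp (glink b a) T.
Definition genus0 b a := euler_count b a = euler_bound b a.

(** Splitting a cycle of [a] adds one cycle to [a]. Either it also splits a cycle
of [b * a], and then at most one component is gained; or it merges two cycles of
[b * a], and then [x] and [y] remain connected through [b * a], so that no
component is gained. In both cases the defect does not grow. *)
Lemma genus_split_le b a x y : x != y -> fconnect a x y ->
  euler_count b a + euler_bound b (a * tperm x y)%g <=
    euler_count b (a * tperm x y)%g + euler_bound b a.
Proof.
move=> xy axy; set a' := (a * _)%g.
have Ea : fcard a' T = (fcard a T).+1.
  by have := fcard_mul_tperm a xy; rewrite axy addn0.
have Ep := fcard_mul_tperm (b * a) xy; rewrite -mulgA -/a' in Ep.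
have ga' z : glink b a' z (a z) ||
    (((a z == x) || (a z == y)) && ((a' z == x) || (a' z == y))).
  rewrite /glink /a' permM; case: tpermP => [->|->|_ _]; rewrite ?eqxx ?orbT //.
have conn : connect (glink b a') x y -> connect (glink b a) =2 connect (glink b a').
  move=> cxy u v; apply/idP/idP; apply: glink_sub => z.
  - by rewrite connect1 // /glink eqxx.
  - have az : connect (glink b a') z (a' z) by rewrite connect1 // /glink eqxx orbT.
    have [|/andP[/orP e1 /orP e2]] := orP (ga' z); first exact: connect1.
    apply: connect_trans az _.
    by case: e1 e2 => /eqP-> [] /eqP->; rewrite ?connect0 // glink_sym.
  - by rewrite connect1 // /glink eqxx.
  have az : connect (glink b a) z (a z) by rewrite connect1 // /glink eqxx orbT.
  have bxy := glink_r b axy.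
  by apply: connect_trans az _; rewrite /a' permM;
    case: tpermP => // ->; rewrite // glink_sym.
have O1 : connect (glink b a') x y -> n_comp (glink b a') T = n_comp (glink b a) T.
  by move/conn=> E; rewrite (eq_n_comp E).
have O2 : n_comp (glink b a') T <= (n_comp (glink b a) T).+1.
  (* Only the component of [x] can fall apart, into those of [x] and [y]. *)
  pose rx := root (glink b a) x.
  pose S := [set x; y] :|: ([set t | roots (glink b a) t] :\ rx).
  have dich z t : connect (glink b a) z t ->
      connect (glink b a') z t || [exists u in pred2 x y, connect (glink b a') z u].
    case/connectP=> p zp ->; elim: p z zp => [|z' p IHp] z /=.
      by rewrite connect0.
    case/andP=> zz' /IHp {}IHp.
    have : connect (glink b a') z z' || [exists u in pred2 x y, connect (glink b a') z u].
      case/orP: zz' => /eqP ->; first by rewrite connect1 // /glink eqxx.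
      case/orP: (ga' z) => [/connect1 -> //|/andP[_ a'z]].
      apply/orP; right; apply/existsP; exists (a' z); rewrite inE a'z connect1 //.
      by rewrite /glink eqxx orbT.
    case/orP=> [c|->]; last by rewrite orbT.
    case/orP: IHp => [/(connect_trans c)->//|/existsP[u /andP[u1 u2]]].
    by apply/orP; right; apply/existsP; exists u; rewrite u1 (connect_trans c).
  have cov z : exists2 t, t \in S & connect (glink b a') z t.
    have [/existsP[u /andP[u1 u2]]|N] :=
        boolP [exists u in pred2 x y, connect (glink b a') z u].
      by exists u => //; move: u1; rewrite !inE => ->.
    exists (root (glink b a) z).
      rewrite !inE roots_root ?andbT; last exact: glink_sym.
      apply/orP; right; rewrite (root_connect (glink_sym b a)).
      apply: contra N => /dich /orP[|//] zx; apply/existsP; exists x.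
      by rewrite inE eqxx zx.
    by case/orP: (dich _ _ (connect_root (glink b a) z)) => //; rewrite (negPf N).
  have := @n_comp_le_cover _ _ (glink_sym b a') T S (fun x _ => cov x).
  move/leq_trans; apply; apply: leq_trans (leq_card_setU _ _) _.
  have -> : n_comp (glink b a) T = #|[set t | roots (glink b a) t]|.
    by rewrite cardsE; apply: eq_card => t; rewrite !inE andbT.
  rewrite [in X in _ <= X](cardsD1 rx) inE roots_root; last exact: glink_sym.
  by rewrite cards2 xy.
rewrite /euler_count /euler_bound Ea.
have [pxy|pxy] := boolP (fconnect (b * a)%g x y); rewrite pxy /= in Ep.
  by gen_lia.
have: connect (glink b a') x y.
  suff p'xy : fconnect (b * a')%g x y.
    apply: connect_sub p'xy => u v /= /eqP <-; rewrite permM.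
    apply: (@connect_trans _ _ (b u)); apply: connect1; rewrite /glink eqxx //.
    by rewrite orbT.
  have := fcard_mul_tperm (b * a')%g xy.
  rewrite -!mulgA tperm2 mulg1; case: (fconnect _ x y) => //= *; gen_lia.
by move/O1 => O; gen_lia.
Qed.

(** Splitting off fixed points reduces to [a = 1], where both sides equal twice
the number of cycles of [b] plus the number of points. *)
Lemma euler_le b a : euler_count b a <= euler_bound b a.
Proof.
have [n] := ubnP #|[pred x | a x != x]|; elim: n a => // n IHn a /ltnSE-le_n.
have [x /= nx|a1] := pickP [pred x | a x != x]; last first.
  have -> : a = 1%g by apply/permP=> x; rewrite perm1; exact/eqP/negbFE/a1.
  rewrite /euler_count /euler_bound mulg1.
  have -> : fcard (1%g : {perm T}) T = #|T|.
    by rewrite -(fcard_id T); apply: eq_fcard => x; rewrite perm1.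
  have -> : n_comp (glink b (1%g : {perm T})) T = fcard b T; last by gen_lia.
  apply: eq_n_comp => x y; apply/idP/idP; apply: connect_sub => u v.
    case/orP=> /eqP ->; first exact: fconnect1.
    by rewrite perm1 connect0.
  by move=> /= /eqP <-; rewrite connect1 // /glink eqxx.
have xax : x != a x by rewrite eq_sym.
have le := genus_split_le b xax (fconnect1 a x).
suff {}IH: #|[pred z | (a * tperm x (a x))%g z != z]| < n.
  by move: (IHn _ IH) le; lia.
apply: leq_trans le_n; apply: proper_card; apply/properP; split.
  apply/subsetP=> z; rewrite !inE permM; case: tpermP => [az _|/perm_inj -> //|//].
  by rewrite az; apply: contraNneq xax => xz; rewrite {2}xz az.
by exists x; rewrite !inE // permM tpermR eqxx.
Qed.

Lemma genus0_split b a x y : genus0 b a -> fconnect a x y -> genus0 b (a * tperm x y)%g.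
Proof.
move=> pba axy; have [->|xy] := eqVneq x y; first by rewrite tperm1 mulg1.
have := genus_split_le b xy axy; have := euler_le b (a * tperm x y)%g.
by rewrite /genus0 in pba * => *; gen_lia.
Qed.

End Genus.

(** * Restricting maps *)

Lemma eq_fcard_in (T : finType) (a : {pred T}) (f g : T -> T) :
  {in a, f =1 g} -> {homo f : x / x \in a} -> fcard f a = fcard g a.
Proof.
move=> fg fa; apply: eq_card => x; rewrite !inE andbC [RHS]andbC.
apply: andb_id2l => xa; rewrite /roots /root.
suff conn : fconnect f x =1 fconnect g x by rewrite (eq_pick conn).
have it n : iter n f x = iter n g x.
  elim: n => //= n <-; apply: fg; elim: n => //= n; exact: fa.
move=> y; apply/idP/idP=> /iter_findex <-; first by rewrite it fconnect_iter.
by rewrite -it fconnect_iter.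
Qed.

Section Transfer.
Variables (D T : finType) (h : D -> T).
Hypothesis inj_h : injective h.

Lemma n_comp_codom (e : rel T) (e' : rel D) :
    connect_sym e -> connect_sym e' -> closed e (codom h) ->
    (forall x y, e (h x) (h y) = e' x y) ->
  n_comp e (codom h) = n_comp e' D.
Proof.
move=> se se' cl E.
have adj : rel_adjunction h e e' (codom h).
  by apply: strict_adjunction => //; move=> x y _; apply: E.
rewrite (adjunction_n_comp h se se' cl adj); apply: eq_n_comp_r => x.
by rewrite !inE codom_f.
Qed.

Lemma n_comp_fix (e : rel T) (a : {pred T}) :
    {in a, forall x y, e x y -> x = y} -> n_comp e a = #|a|.
Proof.
move=> fx; apply: eq_card => x; rewrite inE /= andb_idl // => xa.
have xP p : path e x p -> last x p = x.
  by elim: p => //= y p IHp /andP[/(fx _ xa) <-].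
by rewrite /roots; case/connectP: (connect_root e x) => p /xP -> ->.
Qed.

(** Each point outside the image is a component of its own. *)
Lemma n_comp_transfer (e : rel T) (e' : rel D) :
    connect_sym e -> connect_sym e' ->
    (forall x y, e (h x) (h y) = e' x y) ->
    (forall x y, e x y -> x \notin codom h -> x = y) ->
  n_comp e T + #|D| = n_comp e' D + #|T|.
Proof.
move=> se se' E fx.
have cl : closed e (codom h).
  apply: intro_closed => // x y xy xh; apply: contraLR xh => yh.
  have /connectP[p yp ->] : connect e y x by rewrite se connect1.
  elim: p {x xy} y yh yp => //= z p IHp y yh /andP[yz]; apply: IHp.
  by rewrite -(fx _ _ yz).
have -> : n_comp e T = n_comp e (codom h) + n_comp e [pred t | t \notin codom h].
  exact: (n_compC [in codom h] e).
rewrite (n_comp_codom se se' cl E) (@n_comp_fix e [pred t | t \notin codom h]).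
  have -> : #|T| = #|D| + #|[pred t | t \notin codom h]|.
    by rewrite -(card_codom inj_h) -(cardC [in codom h]).
  by rewrite addnAC addnA.
by move=> x; rewrite !inE => xh y xy; apply: fx xy xh.
Qed.

Lemma fcard_transfer (a : {perm T}) (a' : {perm D}) :
    (forall x, h (a' x) = a (h x)) ->
    (forall x, x \notin codom h -> a x = x) ->
  fcard a T + #|D| = fcard a' D + #|T|.
Proof.
move=> ha fx; apply: n_comp_transfer => [|||x y /= /eqP <- /fx -> //].
- exact/fconnect_sym/perm_inj.
- exact/fconnect_sym/perm_inj.
by move=> x y; rewrite /= -ha (inj_eq inj_h).
Qed.

(** A common fixed point contributes three cycles and one component to one point,
hence the same amount to both sides of Euler's inequality. *)
Lemma genus0_transfer (a b : {perm T}) (a' b' : {perm D}) :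
    (forall x, h (a' x) = a (h x)) -> (forall x, h (b' x) = b (h x)) ->
    (forall x, x \notin codom h -> a x = x /\ b x = x) ->
  genus0 b a -> genus0 b' a'.
Proof.
move=> ha hb fx.
have Fa := fcard_transfer ha (fun x n => (fx x n).1).
have Fb := fcard_transfer hb (fun x n => (fx x n).2).
have Fab : fcard (b * a)%g T + #|D| = fcard (b' * a')%g D + #|T|.
  apply: fcard_transfer => [x|x /fx[ax bx]]; first by rewrite !permM ha hb.
  by rewrite permM bx ax.
have Fg : n_comp (glink b a) T + #|D| = n_comp (glink b' a') D + #|T|.
  apply: n_comp_transfer => [|||x y].
  - exact: glink_sym.
  - exact: glink_sym.
  - by move=> x y; rewrite /glink -ha -hb !(inj_eq inj_h).
  by case/orP=> /eqP -> /fx[ax bx]; rewrite ?ax ?bx.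
by rewrite /genus0 /euler_count /euler_bound; gen_lia.
Qed.

End Transfer.

Section Planar.
Variable T : finType.
Implicit Types a b : {perm T}.

Lemma fcardC a b : fcard (a * b)%g T = fcard (b * a)%g T.
Proof.
apply/eqP; rewrite -(eqn_add2r #|T|); apply/eqP.
apply: (@fcard_transfer _ _ b) => [|x|x]; first exact: perm_inj.
  by rewrite !permM.
by case/negP; rewrite -(permKV b x) codom_f.
Qed.

Lemma connect_glink_l a b x : connect (glink b a) x (b x).
Proof. by rewrite connect1 // /glink eqxx. Qed.

Lemma connect_glink_r a b x : connect (glink b a) x (a x).
Proof. by rewrite connect1 // /glink eqxx orbT. Qed.

Lemma genus0_sym a b : genus0 a b -> genus0 b a.
Proof.
rewrite /genus0 /euler_count /euler_bound (fcardC b a).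
have -> : n_comp (glink b a) T = n_comp (glink a b) T; last by gen_lia.
by apply: eq_glink => x; rewrite ?connect_glink_l ?connect_glink_r.
Qed.

(** Reversal, rotation and faces play symmetric roles: their product is trivial
up to inverses. This exchanges rotation and faces. *)
Lemma genus0_dual b a : genus0 b a -> genus0 b^-1%g (b * a)%g.
Proof.
rewrite /genus0 /euler_count /euler_bound mulKg fcardV.
rewrite -(@eq_glink _ b a b^-1%g (b * a)%g); first by gen_lia.
- by move=> x; rewrite glink_sym -{2}(permK b x) connect_glink_l.
- move=> x; have /connect_trans := connect_glink_l (b * a) b^-1%g x; apply.
  by have := connect_glink_r (b * a) b^-1%g (b^-1%g x); rewrite permM permKV.
- by move=> x; rewrite glink_sym -{2}(permKV b x) connect_glink_l.
move=> x; rewrite permM.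
exact: connect_trans (connect_glink_l _ _ _) (connect_glink_r _ _ _).
Qed.

(** The first-return permutation to the complement of [z], extended by fixing
[z]. Being a multiplication by a transposition, skipping splits a cycle unless
[z] was fixed already. *)
Definition skip1 a z := (a * tperm z (a z))%g.
Definition skip a zs := foldl skip1 a zs.

Lemma skip1E a z x :
  skip1 a z x = if x == z then z else if a x == z then a z else a x.
Proof.
rewrite permM; have [->|xz] := eqVneq x z; first by rewrite tpermR.
have [->|axz] := eqVneq (a x) z; first by rewrite tpermL.
by rewrite tpermD // eq_sym // (inj_eq perm_inj).
Qed.

(** The start [u] of the original path is [z] when [z] has just been left out; then
the new path still is at the predecessor [x] of [z]. *)
Lemma fpath_skip1 a z q u x : x != z -> (u == x) || (u == z) && (a x == z) ->
    fpath a u q -> last u q != z ->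
  fpath (skip1 a z) x [seq y <- q | y != z].
Proof.
elim: q u x => //= y q IHq u x xz ux /andP[/eqP ay yq] lz.
case: (eqVneq y z) => [yz|nyz] /=.
  apply: IHq yq lz => //; apply/orP; right; rewrite yz eqxx /=.
  case/orP: ux => [/eqP <-|/andP[/eqP uz /eqP axz]]; first by rewrite ay yz.
  by rewrite axz eqxx.
rewrite (IHq y y) ?eqxx // andbT skip1E (negPf xz).
case/orP: ux => [/eqP <-|/andP[/eqP uz ->]]; first by rewrite ay (negPf nyz).
by rewrite -uz ay.
Qed.

Lemma orbit_skip1 a z x : x != z ->
  orbit (skip1 a z) x = [seq y <- orbit a x | y != z].
Proof.
move=> xz; have := cycle_orbit (@perm_inj _ a) x; have := orbit_uniq a x.
have [q ->] : exists q, orbit a x = x :: q.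
  by exists (behead (orbit a x)); rewrite /orbit -orderSpred.
move=> Uq cyc.
have xin : x \in [seq y <- x :: q | y != z] by rewrite mem_filter xz mem_head.
rewrite (orbitE _ _ xin).
- by rewrite /= xz /= eqxx rot0.
- have ux : (x == x) || (x == z) && (a x == z) by rewrite eqxx.
  have := fpath_skip1 xz ux cyc.
  by rewrite last_rcons filter_rcons /= xz; apply.
exact: filter_uniq.
Qed.

Lemma orbit_skip a zs x : x \notin zs ->
  orbit (skip a zs) x = [seq y <- orbit a x | y \notin zs].
Proof.
elim: zs a => /= [|z zs IHzs] a xzs.
  by rewrite (@eq_filter _ _ predT) ?filter_predT.
rewrite inE negb_or in xzs; case/andP: xzs => xz xzs.
rewrite IHzs // orbit_skip1 // -filter_predI; apply: eq_filter => y.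
by rewrite /= inE negb_or andbC.
Qed.

Lemma fconnect_skip a zs x y : x \notin zs -> y \notin zs ->
  fconnect (skip a zs) x y = fconnect a x y.
Proof. by move=> xz yz; rewrite !fconnect_orbit orbit_skip // mem_filter yz. Qed.

Lemma skip_fixed a zs x : a x = x -> skip a zs x = x.
Proof.
elim: zs a => //= z zs IHzs a ax; apply: IHzs; rewrite skip1E ax.
by case: eqVneq.
Qed.

Lemma skip_in a zs z : z \in zs -> skip a zs z = z.
Proof.
elim: zs a => //= z0 zs IHzs a; rewrite inE => /predU1P[<-|]; last exact: IHzs.
by apply: skip_fixed; rewrite skip1E eqxx.
Qed.

Lemma skip_out a zs x : x \notin zs -> a x \notin zs -> skip a zs x = a x.
Proof.
elim: zs a => //= z zs IHzs a; rewrite !inE !negb_or => /andP[xz xzs] /andP[az azs].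
have E : skip1 a z x = a x by rewrite skip1E (negPf xz) (negPf az).
by rewrite IHzs ?E.
Qed.

Lemma skip_over a zs x : x \notin zs -> a x \in zs -> a (a x) \notin zs ->
  skip a zs x = a (a x).
Proof.
elim: zs a => //= z zs IHzs a; rewrite !inE !negb_or => /andP[xz xzs] axz /andP[aaz aazs].
have [az|naz] := eqVneq (a x) z.
  have E : skip1 a z x = a (a x) by rewrite skip1E (negPf xz) az eqxx.
  by transitivity (skip1 a z x); [apply: skip_out; rewrite ?E | exact: E].
rewrite (negPf naz) /= in axz.
have E : skip1 a z x = a x by rewrite skip1E (negPf xz) (negPf naz).
have E2 : skip1 a z (a x) = a (a x) by rewrite skip1E (negPf naz) (negPf aaz).
by rewrite IHzs ?E ?E2.
Qed.

(** Deleting half-edges from the rotation deletes them from the faces. *)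
Lemma skip_mul a b zs : {in zs, forall z, b z = z} ->
  skip (b * a)%g zs = (b * skip a zs)%g.
Proof.
elim: zs a => //= z zs IHzs a bz; rewrite -IHzs => [|z' z'zs]; last first.
  by apply: bz; rewrite inE z'zs orbT.
by congr (skip _ zs); rewrite /skip1 permM bz ?mem_head // mulgA.
Qed.

Lemma genus0_skip b a zs : genus0 b a -> genus0 b (skip a zs).
Proof.
by elim: zs a => //= z zs IHzs a ba; apply/IHzs/genus0_split/fconnect1.
Qed.

Lemma perm_next a x : a x = next (orbit a x) x.
Proof.
have := next_cycle (cycle_orbit (@perm_inj _ a) x) (in_orbit a x).
by move/eqP.
Qed.

End Planar.

(** Skipping the darts outside the image of [h] in both permutations only splits
cycles; what is left lives on [D]. *)
Lemma submap (D T : finType) (h : D -> T) (e' : {perm D}) (e r : {perm T}) :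
    injective h -> (forall x, h (e' x) = e (h x)) -> genus0 e r ->
  exists r' : {perm D}, [/\ genus0 e' r',
    forall x, h (r' x) = skip r (enum [pred t | t \notin codom h]) (h x) &
    forall x y, fconnect r' x y = fconnect r (h x) (h y)].
Proof.
move=> inj_h he per; set zs := enum _.
have zsP x : (x \in zs) = (x \notin codom h) by rewrite mem_enum.
have clr x : skip r zs (h x) \in codom h.
  have : skip r zs (h x) \in orbit (skip r zs) (h x) by rewrite mem_orbit.
  by rewrite orbit_skip ?zsP ?codom_f // mem_filter zsP negbK => /andP[].
pose f x := iinv (clr x).
have fE x : h (f x) = skip r zs (h x) by rewrite f_iinv.
have inj_f : injective f.
  by move=> x y /(congr1 h); rewrite !fE => /perm_inj /inj_h.
exists (perm inj_f).
have hE x : h (perm inj_f x) = skip r zs (h x) by rewrite permE fE.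
split=> // [|x y].
  apply: (@genus0_transfer _ _ h inj_h (skip r zs) (skip e zs)) => // [x|x xh|].
  - by rewrite he skip_out // zsP ?negbK ?codom_f // -he codom_f.
  - by rewrite !skip_in ?zsP.
  by apply/genus0_skip/genus0_sym/genus0_skip/genus0_sym.
rewrite -(@fconnect_skip _ r zs) ?zsP ?negbK ?codom_f //.
apply/idP/idP => [/iter_findex <-|].
  by elim: findex => [|n IHn]; rewrite ?connect0 //= hE (connect_trans IHn) ?fconnect1.
have conn u : fconnect (skip r zs) (h x) u ->
    exists2 y', u = h y' & fconnect (perm inj_f) x y'.
  move=> /iter_findex <-; elim: findex => [|n [y' /= -> IHn]]; first by exists x.
  by exists (perm inj_f y'); rewrite ?hE // (connect_trans IHn) ?fconnect1.
by case/conn=> y' /inj_h ->.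
Qed.

(** * Cutting a planar map in two *)

(** [C] is the set of darts of the cut edges and [A] one of the two sides. The
reversal is [rev_on * rev_off], where [rev_on] reverses the cut darts only and
[rev_off] the other darts only, so [rev_off] is the reversal after the cut edges
have been cut in half. Correspondingly [f] traces the faces before and
[face_off] those after; [cut_next] maps a cut half-edge to the next one on its
face. *)
Section CutOrder.
Variables (T : finType) (rev_off rev_on r : {perm T}) (A C : {pred T}).
Let face_off := (rev_off * r)%g.
Let f := (rev_on * rev_off * r)%g.
Let cut_next := skip face_off (enum [predC C]).

Hypothesis rev_on_out : forall x, x \notin C -> rev_on x = x.
Hypothesis rev_on_C : forall x, x \in C -> rev_on x \in C.
Hypothesis rev_on_A : forall x, x \in C -> (rev_on x \in A) = (x \notin A).
Hypothesis face_off_A : forall x, (face_off x \in A) = (x \in A).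
Hypothesis genus0_s : genus0 rev_off r.
Hypothesis genus0_f : genus0 (rev_on * rev_off)%g r.
Hypothesis conn_s : n_comp (glink rev_off r) T = 2.
Hypothesis conn_f : n_comp (glink (rev_on * rev_off)%g r) T = 1.
Hypothesis count_e : fcard rev_off T = fcard (rev_on * rev_off)%g T + #|[predI C & A]|.
Variable c0 : T.
Hypothesis c0C : c0 \in C.

(* The points on faces that do not meet the cut: there both maps agree. *)
Let X : {pred T} := [pred x | [forall c in C, ~~ fconnect face_off x c]].

Let fE : f = (rev_on * face_off)%g. Proof. by rewrite /f mulgA. Qed.

Let symfs := fconnect_sym (@perm_inj _ face_off).
Let symf := fconnect_sym (@perm_inj _ f).

Let connA x y : fconnect face_off x y -> (x \in A) = (y \in A).
Proof. by apply: closed_connect => u v /= /eqP <-; rewrite face_off_A. Qed.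

Let XN x : x \notin X -> exists2 c, c \in C & fconnect face_off x c.
Proof.
rewrite inE negb_forall => /existsP[c]; rewrite negb_imply negbK => /andP[] cC.
by exists c.
Qed.

Let closed_Xs : fclosed face_off X.
Proof.
move=> x y /= /eqP <-; rewrite !inE; apply: eq_forallb => c.
by rewrite (same_fconnect1 (@perm_inj _ face_off)).
Qed.

Let X_C x : x \in X -> x \notin C.
Proof. by rewrite inE => /forall_inP h; apply/negP=> /h; rewrite connect0. Qed.

Let clX : fclosed f X.
Proof.
apply: (intro_closed symf) => x y /= /eqP <- xX.
by rewrite fE permM rev_on_out ?X_C // -(fclosed1 closed_Xs).
Qed.

Let cardX : fcard f X = fcard face_off X.
Proof.
apply: eq_fcard_in => x xX; first by rewrite fE permM rev_on_out ?X_C.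
by rewrite -(fclosed1 clX).
Qed.

Let to_C n x : iter n face_off x \in C ->
  exists2 c, c \in C & fconnect f x c && ((c \in A) == (x \in A)).
Proof.
elim: n x => [|n IHn] x xn; first by exists x; rewrite // connect0 eqxx.
have [xC|xC] := boolP (x \in C); first by exists x; rewrite // connect0 eqxx.
rewrite iterSr in xn; have [c cC /andP[fc cA]] := IHn _ xn.
exists c; rewrite // -(face_off_A x) cA andbT.
have fx : f x = face_off x by rewrite fE permM rev_on_out.
by rewrite (same_fconnect1 (@perm_inj _ f)) fx.
Qed.

(* On crossing a cut edge, a face passes from one side to the other, and it must *)
(* cross back; hence every face that meets the cut has a cut dart in [A].        *)
Let cover x : x \notin X -> exists2 c, c \in [predI C & A] & fconnect f x c.
Proof.
case/XN=> c cC /iter_findex E; move: cC; rewrite -E => /to_C[c1 c1C /andP[fc _]].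
have [c1A|c1A] := boolP (c1 \in A); first by exists c1; rewrite // inE c1C.
have: fconnect face_off (f c1) (rev_on c1).
  by rewrite fE permM symfs fconnect1.
move/iter_findex => E1; have := rev_on_C c1C; rewrite -E1 => /to_C[c2 c2C /andP[fc2 c2A]].
exists c2; first by rewrite inE c2C (eqP c2A) fE permM face_off_A rev_on_A.
by apply: connect_trans fc _; rewrite (same_fconnect1 (@perm_inj _ f)).
Qed.

Let CX x : x \in C -> x \in [predC X].
Proof. by move=> xC; rewrite inE; apply/negP=> /X_C; rewrite xC. Qed.

(* Compares the Euler equalities before and after: cutting the k edges of the cut *)
(* adds k cycles to the reversal and one component.                               *)
Let count_faces : fcard face_off [predC X] + #|[predI C & A]| = fcard f [predC X] + 2.
Proof.
have Es := n_compC X (frel face_off); have Ef := n_compC X (frel f).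
rewrite -[fcard face_off T]/(fcard (rev_off * r)%g T) in Es.
rewrite -[fcard f T]/(fcard (rev_on * rev_off * r)%g T) in Ef.
have := genus0_s; have := genus0_f; rewrite /genus0 /euler_count /euler_bound conn_s conn_f.
rewrite count_e -/f -/face_off => Pf Ps; move: Es Ef cardX Pf Ps.
by gen_lia.
Qed.

Let clXsC : fclosed face_off [predC X]. Proof. exact: predC_closed closed_Xs. Qed.
Let faces_le : fcard f [predC X] <= #|[predI C & A]|.
Proof. by apply: n_comp_le_cover => // x xX; apply: cover. Qed.

Let indep_le (S : {set T}) : {subset S <= C} ->
  {in S &, forall x y, fconnect face_off x y -> x = y} -> #|S| <= 2.
Proof.
move=> SC /(n_comp_ge_indep symfs clXsC) h; have := count_faces; have := faces_le.
by have := h (fun x xS => CX (SC x xS)); gen_lia.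
Qed.

Let sep c : c \in C -> ~~ fconnect face_off c (rev_on c).
Proof. by move=> cC; apply/negP=> /connA; rewrite rev_on_A //; case: (c \in A). Qed.

(** Three half-edges on different faces would give three faces that meet the cut,
but [count_faces] and [faces_le] allow only two. *)
Lemma cut_one_face c c' : c \in C -> c' \in C -> (c \in A) = (c' \in A) ->
  fconnect face_off c c'.
Proof.
move=> cC c'C E; apply: contraT => N.
have cc' : c != c' by apply: contraNneq N => ->; rewrite connect0.
have N1 := sep cC.
have N2 : ~~ fconnect face_off c' (rev_on c).
  by apply/negP=> /connA; rewrite rev_on_A // -E; case: (c \in A).
have ne1 : c != rev_on c by apply: contraNneq N1 => <-; rewrite connect0.
have ne2 : c' != rev_on c by apply: contraNneq N2 => <-; rewrite connect0.
suff: #|[set c; c'; rev_on c]| <= 2.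
  by rewrite -setUA cardsU1 cards2 !inE negb_or cc' ne1 ne2.
apply: indep_le.
  by move=> x; rewrite !inE -orbA; case/or3P=> /eqP ->; rewrite ?rev_on_C.
have Nf := (negPf N, negPf N1, negPf N2).
move=> x y; rewrite !inE -!orbA; case/or3P=> /eqP ->; case/or3P=> /eqP -> //;
  by rewrite ?Nf // symfs Nf.
Qed.

(* If two cut darts of [A] were on a common face, fewer of them than there *)
(* are cut edges would cover the faces that meet the cut, and by [count_faces]    *)
(* fewer than two such faces would be left after the cut.                         *)
Let fconnect_inj c c' : c \in [predI C & A] -> c' \in [predI C & A] ->
  fconnect f c c' -> c = c'.
Proof.
move=> cCA c'CA cc'; apply/eqP/contraT => ne.
have cC : c \in C by case/andP: cCA.
have : #|[set c; rev_on c]| <= fcard face_off [predC X].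
  apply: (n_comp_ge_indep symfs clXsC) => [x|x y].
    by rewrite !inE => /orP[] /eqP -> //; apply: CX; rewrite ?rev_on_C.
  rewrite !inE => /orP[] /eqP -> /orP[] /eqP -> //;
    by rewrite ?(negPf (sep cC)) // symfs (negPf (sep cC)).
have : fcard f [predC X] <= #|[predD1 [predI C & A] & c']|.
  apply: n_comp_le_cover => // x /cover[c1 c1CA xc1].
  have [E|c1c'] := eqVneq c1 c'; last by exists c1; rewrite // inE c1c'.
  exists c; first by rewrite inE ne.
  by apply: connect_trans xc1 _; rewrite E symf.
have := count_faces; rewrite (cardD1 c' [predI C & A]) c'CA cards2.
have -> : c != rev_on c by apply: contraNneq (sep cC) => <-; rewrite connect0.
rewrite /=; set m := fcard face_off _; set n := fcard f _; set k := #|_|.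
by move: m n k => m n k; lia.
Qed.

Let cut_next_f : skip f (enum [predC C]) = (rev_on * cut_next)%g.
Proof. by rewrite fE skip_mul // => z; rewrite mem_enum => /rev_on_out. Qed.

Let cut_next_C x : x \in C -> (cut_next x \in C) && ((cut_next x \in A) == (x \in A)).
Proof.
move=> xC; have: cut_next x \in orbit cut_next x by rewrite mem_orbit.
rewrite orbit_skip; last by rewrite mem_enum inE xC.
rewrite mem_filter mem_enum inE negbK => /andP[->].
by rewrite -fconnect_orbit => /connA ->; rewrite eqxx.
Qed.

(** Following a face from a cut dart over two crossings leads to a cut dart on the
same side, which is the same one by [fconnect_inj]. So conjugation by [rev_on]
inverts [cut_next]: the cyclic orders of the cut on both sides are opposite. *)
Lemma cut_reverse c : c \in C -> cut_next (rev_on (cut_next (rev_on c))) = c.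
Proof.
have main c1 : c1 \in [predI C & A] -> cut_next (rev_on (cut_next (rev_on c1))) = c1.
  rewrite inE => /andP[cC cA]; set c2 := cut_next (rev_on c1).
  have /andP[c2C c2A] := cut_next_C (rev_on_C cC); rewrite -/c2 rev_on_A // cA in c2A.
  have /andP[c3C c3A] := cut_next_C (rev_on_C c2C); rewrite rev_on_A // (eqP c2A) in c3A.
  apply/esym/fconnect_inj; rewrite ?inE ?cC ?cA ?c3C ?(eqP c3A) //.
  rewrite -(@fconnect_skip _ f (enum [predC C])) ?mem_enum ?inE ?cC ?c3C // cut_next_f.
  have -> : cut_next (rev_on c2) = iter 2 (rev_on * cut_next)%g c1 by rewrite /= !permM.
  exact: fconnect_iter.
move=> cC; have [cA|cA] := boolP (c \in A); first by apply: main; rewrite inE cC.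
have /andP[c1C c1A] := cut_next_C (rev_on_C cC).
have := main (cut_next (rev_on c)); rewrite inE c1C (eqP c1A) rev_on_A // cA => /(_ isT).
by move/perm_inj/perm_inj.
Qed.

End CutOrder.

(** * Darts of a graph, and a plane graph cut along a bond *)

Section Darts.
Variable G : graph.

Lemma dart_revK : involutive (@dart_rev G).
Proof. by move=> d; apply: val_inj => /=; case: (val d). Qed.

Definition rev_perm : {perm dart G} := perm (inv_inj dart_revK).

Lemma rev_permE d : rev_perm d = dart_rev d. Proof. by rewrite permE. Qed.

Lemma dart_eq (d e : dart G) :
  source d = source e -> source (dart_rev d) = source (dart_rev e) -> d = e.
Proof.
by case: d e => [[x y] p] [[x' y'] p'] /= ? ?; apply: val_inj; congr pair.
Qed.

Lemma dart_adj (d : dart G) : adj (source d) (source (dart_rev d)).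
Proof. exact: valP d. Qed.

Lemma dart_of x y : adj x y ->
  exists2 d : dart G, source d = x & source (dart_rev d) = y.
Proof. by move=> xy; exists (exist _ (x, y) xy). Qed.

Lemma dart_rev_neq (d : dart G) : dart_rev d != d.
Proof.
apply/eqP=> E; have := dart_adj d; rewrite -/(source _) E.
by rewrite adj_irr.
Qed.

Lemma order_rev (d : dart G) : fingraph.order (@dart_rev G) d = 2.
Proof.
have c : fcycle (@dart_rev G) [:: d; dart_rev d] by rewrite /= eqxx dart_revK eqxx.
by rewrite (order_cycle c) ?mem_head //= inE eq_sym dart_rev_neq.
Qed.

Lemma card_fcard_rev (a : {pred dart G}) : fclosed (@dart_rev G) a ->
  fcard (@dart_rev G) a * 2 = #|a|.
Proof.
apply: fcard_order_set; first exact: inv_inj dart_revK.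
by apply/subsetP=> d _; rewrite inE order_rev.
Qed.

Lemma face_perm (r : {perm dart G}) : face r =1 (rev_perm * r)%g.
Proof. by move=> d; rewrite permM rev_permE. Qed.

Lemma card_dart : #|dart G| = fcard (@dart_rev G) (dart G) * 2.
Proof. by symmetry; apply: card_fcard_rev. Qed.

Lemma fcard_rev_perm : fcard rev_perm (dart G) = fcard (@dart_rev G) (dart G).
Proof. by apply: eq_fcard => d; rewrite rev_permE. Qed.

Lemma spherical_genus0 (r : {perm dart G}) : spherical r <-> genus0 rev_perm r.
Proof.
have E2 : fcard (face r) (dart G) = fcard (rev_perm * r)%g (dart G).
  exact/eq_fcard/face_perm.
have E3 : n_comp (dart_link r) (dart G) = n_comp (glink rev_perm r) (dart G).
  by apply/eq_n_comp/eq_connect => x y; rewrite /glink /dart_link rev_permE orbC.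
rewrite /spherical /genus0 /euler_count /euler_bound card_dart E2 E3 fcard_rev_perm.
move: (n_comp_mem _ _) (n_comp_mem _ _) (n_comp_mem _ _) (n_comp_mem _ _).
by move=> v f e c; split=> E; lia.
Qed.

Lemma rotation_source (r : {perm dart G}) (d : dart G) :
  rotation_system r -> source (r d) = source d.
Proof. by move/(_ d (r d)) => /esym; rewrite fconnect1 => /eqP. Qed.

End Darts.

Lemma connect_darts (T V : finType) (src : T -> V) (e r : {perm T}) (R : rel V) :
    (forall t t', src t = src t' -> fconnect r t t') ->
    (forall x y, R x y -> exists2 t, src t = x & src (e t) = y) ->
  forall t t', connect R (src t) (src t') -> connect (glink e r) t t'.
Proof.
move=> hr he t t' /connectP[p]; elim: p t => [|y p IHp] t /=.
  by move=> _ /esym/hr; apply: glink_r.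
case/andP=> /he[d /esym/hr/(glink_r e) td <-] pp /(IHp _ pp) ed.
by apply: connect_trans td _; apply: connect_trans ed; apply: connect_glink_l.
Qed.

Lemma orbit_map (D T : finType) (h : D -> T) (a' : D -> D) (a : T -> T) x :
    injective h -> injective a' -> injective a ->
    (forall x, h (a' x) = a (h x)) ->
  map h (orbit a' x) = orbit a (h x).
Proof.
move=> inj_h inj_a' inj_a ha; set p := map h _.
have Up : uniq p by rewrite map_inj_uniq ?orbit_uniq.
have hx : h x \in p by rewrite map_f ?in_orbit.
have cyc : fcycle a p.
  rewrite cycle_map; apply: sub_cycle (cycle_orbit inj_a' x) => u v /=.
  by move=> /eqP <-; rewrite ha.
rewrite (orbitE cyc Up hx) index_map //.
by rewrite /orbit -orderSpred /= eqxx rot0.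
Qed.

(** Every element of [C] is followed by one outside [C] with the same image under
[s]; replacing each by its successor embeds the one list into the other. *)
Lemma subseq_shift (T : eqType) (V : eqType) (s : T -> V) (C : pred T) (f : T -> T) x p :
    {in x :: p, forall y, C y -> ~~ C (f y) /\ s (f y) = s y} ->
    path (frel f) x p -> ~~ C (last x p) ->
  subseq (map s (filter C (x :: p))) (map s (filter (predC C) (x :: p))).
Proof.
have [n] := ubnP (size p); elim: n x p => // n IHn x p /ltnSE szp fC xp lp.
have [Cx|Cx] := boolP (C x).
  have [Cfx sfx] := fC _ (mem_head _ _) Cx.
  case: p xp lp szp fC => [|y p] /=; first by rewrite Cx.
  case/andP=> /eqP <- yp lp szp fC.
  rewrite Cx (negPf Cfx) /= sfx eqxx.
  case: p yp lp szp fC => [|z p] //= /andP[_ zp] lp szp fC.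
  apply: IHn (ltnW szp) _ zp lp => w wp; apply: fC.
  by rewrite 2!in_cons wp !orbT.
case: p xp lp szp fC => [|y p] /=; first by rewrite (negPf Cx).
case/andP=> _ yp lp szp fC; rewrite (negPf Cx) [in X in subseq _ X]/=.
apply: subseq_trans (IHn _ _ szp _ yp lp) (subseq_cons _ _) => z zp; apply: fC.
by rewrite in_cons zp orbT.
Qed.

Lemma orbit_succ (T : finType) (f : T -> T) x : injective f ->
  exists2 p, orbit f x = x :: p & orbit f (f x) = rcons p x.
Proof.
move=> inj_f; exists (traject f (f x) (fingraph.order f x).-1).
  by rewrite /orbit -{1}orderSpred.
rewrite /orbit (order_id_cycle (cycle_orbit inj_f x)) -{1}orderSpred trajectSr.
by rewrite -iterSr orderSpred iter_order.
Qed.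

(** A bond of the plane graph [H] whose edges form a matching ([cut_uniq]). *)
Section Cut.
Variables (H : graph) (r : {perm dart H}) (side : pred H).
Hypothesis rot_r : rotation_system r.
Hypothesis sph_r : spherical r.
Hypothesis conn_H : forall x y : H, connect adj x y.
Hypothesis conn_side : forall x y : H, side x = side y ->
  connect (fun u v => adj u v && (side u == side v)) x y.

Definition cut : {pred dart H} :=
  [pred d | side (source d) != side (source (dart_rev d))].

Hypothesis cut_uniq : forall c c', c \in cut -> c' \in cut ->
  source c = source c' -> c = c'.

Lemma cut_rev d : (dart_rev d \in cut) = (d \in cut).
Proof. by rewrite !inE dart_revK eq_sym. Qed.

Definition rev_off := skip (rev_perm H) (enum cut).

Lemma rev_offE d : rev_off d = if d \in cut then d else dart_rev d.
Proof.
case: ifPn => dC; first by rewrite skip_in ?mem_enum.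
by rewrite skip_out ?rev_permE // mem_enum ?cut_rev.
Qed.

Definition rev_on := skip (rev_perm H) (enum [predC cut]).

Lemma rev_onE d : rev_on d = if d \in cut then dart_rev d else d.
Proof.
case: ifPn => dC; last by rewrite skip_in ?mem_enum.
by rewrite skip_out ?rev_permE // mem_enum; apply/negPn; rewrite //= ?cut_rev.
Qed.

Lemma rev_on_off : (rev_on * rev_off)%g = rev_perm H.
Proof.
apply/permP=> d; rewrite permM rev_permE rev_onE; case: ifPn => dC.
  by rewrite rev_offE cut_rev dC.
by rewrite rev_offE (negPf dC).
Qed.

Definition face_off := (rev_off * r)%g.
Definition cut_next := skip face_off (enum [predC cut]).

Lemma face_off_side d : side (source (face_off d)) = side (source d).
Proof.
rewrite permM rotation_source // rev_offE; case: ifPn => //.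
by rewrite inE negbK => /eqP.
Qed.

Lemma rev_on_side d : d \in cut -> side (source (rev_on d)) = ~~ side (source d).
Proof.
move=> dC; rewrite rev_onE dC; move: dC; rewrite inE.
by case: (side _); case: (side _).
Qed.

Lemma rev_onK : involutive rev_on.
Proof.
move=> d; rewrite [rev_on d]rev_onE; case: ifPn => dC; last by rewrite rev_onE (negPf dC).
by rewrite rev_onE cut_rev dC dart_revK.
Qed.

Lemma rev_on_cut d : d \in cut -> rev_on d \in cut.
Proof. by move=> dC; rewrite rev_onE dC cut_rev. Qed.

Let A : {pred dart H} := [pred d | side (source d)].

Variable c0 : dart H.
Hypothesis c0C : c0 \in cut.

Lemma genus0_off : genus0 rev_off r.
Proof. by apply/genus0_sym/genus0_skip/genus0_sym/spherical_genus0. Qed.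

Let same_r t t' : source t = source t' -> fconnect r t t'.
Proof. by move=> E; rewrite rot_r E. Qed.

Lemma connect_off t t' : side (source t) = side (source t') ->
  connect (glink rev_off r) t t'.
Proof.
move=> E; apply: (connect_darts same_r _ (conn_side E)) => x y /andP[xy /eqP sxy].
have [d dx dy] := dart_of xy; exists d; rewrite ?rev_offE // ifN //.
by rewrite inE negbK dx dy sxy.
Qed.

Lemma n_comp_off : n_comp (glink rev_off r) (dart H) = 2.
Proof.
have cl : closed (glink rev_off r) A.
  apply: (intro_closed (glink_sym _ _)) => x y /orP[] /eqP ->.
    rewrite !inE rev_offE; case: ifPn => //; rewrite inE negbK => /eqP ->//.
  by rewrite !inE rotation_source.
have ne : c0 != rev_on c0.
  by apply/eqP=> E; have := rev_on_side c0C; rewrite -E; case: (side _).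
apply/eqP; rewrite eqn_leq; apply/andP; split.
  have -> : 2 = #|[set c0; rev_on c0]| by rewrite cards2 ne.
  apply: (n_comp_le_cover (glink_sym _ _)) => // x _.
  have [E|N] := eqVneq (side (source x)) (side (source c0)).
    by exists c0; rewrite ?set21 ?connect_off.
  exists (rev_on c0); rewrite ?set22 ?connect_off // rev_on_side //.
  by move: N; case: (side _); case: (side _).
have <- : #|[set c0; rev_on c0]| = 2 by rewrite cards2 ne.
apply: (n_comp_ge_indep (glink_sym _ _)) => // x y.
have N : ~~ connect (glink rev_off r) c0 (rev_on c0).
  by apply/negP=> /(closed_connect cl); rewrite !inE rev_on_side //; case: (side _).
rewrite !inE => /orP[] /eqP -> /orP[] /eqP -> //.
  by rewrite (negPf N).
by rewrite glink_sym (negPf N).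
Qed.

Lemma n_comp_connected : n_comp (glink (rev_perm H) r) (dart H) = 1.
Proof.
apply/eqP; rewrite eqn_leq; apply/andP; split.
  rewrite -(card1 c0); apply: (n_comp_le_cover (glink_sym _ _)) => // x _.
  exists c0; rewrite ?inE //; apply: (connect_darts same_r _ (conn_H _ _)) => u v uv.
  by have [d du dv] := dart_of uv; exists d; rewrite ?rev_permE.
rewrite -(card1 c0); apply: (n_comp_ge_indep (glink_sym _ _)) => // x y.
by rewrite !inE => /eqP -> /eqP ->.
Qed.

Lemma card_cut : #|cut| = 2 * #|[predI cut & A]|.
Proof.
rewrite -(cardID A cut) mul2n -addnn; congr (_ + _).
rewrite -[RHS](card_image (f := rev_on)); last exact: perm_inj.
apply: eq_card => d; apply/andP/imageP => [[dA dC]|[d' /andP[dC dA] ->]].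
  exists (rev_on d); last by rewrite rev_onK.
  by apply/andP; split; [apply: rev_on_cut|rewrite inE rev_on_side].
by split; [rewrite inE rev_on_side // negbK | apply: rev_on_cut].
Qed.

Lemma fcard_off :
  fcard rev_off (dart H) = fcard (rev_perm H) (dart H) + #|[predI cut & A]|.
Proof.
have cl : fclosed (@dart_rev H) cut by move=> x y /= /eqP <-; rewrite cut_rev.
have cl' : fclosed (@dart_rev H) [predC cut] by apply: predC_closed.
have E1 := card_fcard_rev cl.
have E2 : fcard rev_off cut = #|cut|.
  by apply: n_comp_fix => x xC y /= /eqP <-; rewrite rev_offE xC.
have E3 : fcard rev_off [predC cut] = fcard (@dart_rev H) [predC cut].
  apply: eq_fcard_in => x xC; first by rewrite rev_offE ifN.
  by rewrite rev_offE ifN // inE cut_rev.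
have := n_compC cut (frel rev_off); have := n_compC cut (frel (@dart_rev H)).
rewrite (eq_fcard (@rev_permE H)) E2 E3; have := card_cut; gen_lia.
Qed.

Let rev_on_out x : x \notin cut -> rev_on x = x.
Proof. by move=> xC; rewrite rev_onE (negPf xC). Qed.

Let rev_on_A x : x \in cut -> (rev_on x \in A) = (x \notin A).
Proof. by move=> xC; rewrite !inE rev_on_side. Qed.

Let face_off_A x : (face_off x \in A) = (x \in A).
Proof. by rewrite !inE face_off_side. Qed.

Let genus0_rev : genus0 (rev_on * rev_off)%g r.
Proof. by rewrite rev_on_off; apply: (proj1 (spherical_genus0 r)). Qed.

Let conn_rev : n_comp (glink (rev_on * rev_off)%g r) (dart H) = 1.
Proof. by rewrite rev_on_off n_comp_connected. Qed.

Let count_rev :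
  fcard rev_off (dart H) = fcard (rev_on * rev_off)%g (dart H) + #|[predI cut & A]|.
Proof. by rewrite rev_on_off fcard_off. Qed.

Lemma cut_same_face c c' : c \in cut -> c' \in cut ->
  side (source c) = side (source c') -> fconnect face_off c c'.
Proof.
exact: (cut_one_face rev_on_out rev_on_cut rev_on_A face_off_A genus0_off
  genus0_rev n_comp_off conn_rev count_rev c0C).
Qed.

Lemma cut_next_reverse c : c \in cut -> cut_next (rev_on (cut_next (rev_on c))) = c.
Proof.
exact: (cut_reverse rev_on_out rev_on_cut rev_on_A face_off_A genus0_off
  genus0_rev n_comp_off conn_rev count_rev c0C).
Qed.

Lemma orbit_cut_next c : c \in cut ->
  orbit cut_next c = [seq d <- orbit face_off c | d \in cut].
Proof.
move=> cC; rewrite orbit_skip; last by rewrite mem_enum; apply/negPn.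
by apply: eq_filter => d; rewrite mem_enum; apply: negbK.
Qed.

Lemma face_off_conn_side c d : fconnect face_off c d -> side (source c) = side (source d).
Proof.
apply: (@fconnect_invariant _ _ _ (fun d => side (source d))) => x.
by apply/eqP; apply: face_off_side.
Qed.

Lemma mem_orbit_cut_next c d : c \in cut ->
  (d \in orbit cut_next c) = (d \in cut) && (side (source d) == side (source c)).
Proof.
move=> cC; rewrite orbit_cut_next // mem_filter -fconnect_orbit.
apply: andb_id2l => dC; apply/idP/eqP => [/face_off_conn_side //|E].
exact: cut_same_face.
Qed.

Lemma orbit_cut_next_rev c : c \in cut ->
  exists i, orbit cut_next (rev_on c) = rot i (rev (map rev_on (orbit cut_next c))).
Proof.
move=> cC; set p := rev _.
have Up : uniq p by rewrite rev_uniq map_inj_uniq ?orbit_uniq //; exact: perm_inj.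
have cp : rev_on c \in p by rewrite mem_rev map_f ?in_orbit.
have cyc : fcycle cut_next p.
  rewrite rev_cycle cycle_map.
  have := cycle_orbit (@perm_inj _ cut_next) c; apply: (@sub_in_cycle _ (mem cut)).
    move=> x y xC yC /= /eqP xy.
    have := cut_next_reverse (rev_on_cut xC); rewrite rev_onK xy => ->; exact: eqxx.
  by apply/allP=> d; rewrite mem_orbit_cut_next // => /andP[].
by exists (index (rev_on c) p); rewrite (orbitE cyc).
Qed.

Lemma cut_succ d : d \in cut -> face_off d = r d.
Proof. by move=> dC; rewrite permM rev_offE dC. Qed.

Lemma rot_cut d : d \in cut -> r d \in cut -> r d = d.
Proof. by move=> dC rC; apply: cut_uniq; rewrite // rotation_source. Qed.

(** [iota] identifies [K] with the side of [c]. *)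
Section SideGraph.
Variables (K : graph) (iota : K -> H) (c : dart H).
Hypothesis inj_i : injective iota.
Hypothesis adj_i : forall x y, adj (iota x) (iota y) = adj x y.
Hypothesis conn_K : forall x y : K, connect adj x y.
Hypothesis cC : c \in cut.
Hypothesis side_i : forall u, side u = side (source c) <-> exists x, u = iota x.

Lemma side_dart_proof (d : dart K) : adj (iota (val d).1) (iota (val d).2).
Proof. by rewrite adj_i (valP d). Qed.

Definition side_dart (d : dart K) : dart H := exist _ (_, _) (side_dart_proof d).

Lemma source_side_dart d : source (side_dart d) = iota (source d).
Proof. by []. Qed.

Lemma rev_side_dart d : side_dart (dart_rev d) = dart_rev (side_dart d).
Proof. exact: val_inj. Qed.

Lemma side_dart_inj : injective side_dart.
Proof.
by case=> [[x y] p] [[x' y'] p'] [/inj_i ? /inj_i ?]; apply: val_inj; congr pair.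
Qed.

Lemma side_iota x : side (iota x) = side (source c).
Proof. by apply/side_i; exists x. Qed.

Lemma codom_side_dart d :
  (d \in codom side_dart) = (d \notin cut) && (side (source d) == side (source c)).
Proof.
apply/codomP/andP => [[d' ->]|[dC /eqP dc]].
  by rewrite inE negbK -rev_side_dart !source_side_dart !side_iota !eqxx.
have /side_i[x xd] := dc.
have: side (source (dart_rev d)) = side (source c).
  by rewrite -dc; move: dC; rewrite inE negbK => /eqP.
case/side_i=> y yd; have xy : adj x y by rewrite -adj_i -xd -yd dart_adj.
by have [d' d'x d'y] := dart_of xy; exists d'; apply: dart_eq;
   rewrite -?rev_side_dart source_side_dart ?d'x ?d'y.
Qed.

Lemma side_map : exists r' : {perm dart K}, [/\ rotation_system r', spherical r' &
  forall d, side_dart (face r' d) = skip face_off (enum cut) (side_dart d)].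
Proof.
have hrev x : side_dart (rev_perm K x) = rev_perm H (side_dart x).
  by rewrite !rev_permE rev_side_dart.
have [r' [plr r'E r'C]] := submap side_dart_inj hrev (proj1 (spherical_genus0 r) sph_r).
exists r'; split; [|exact/spherical_genus0|].
  by move=> d d'; rewrite r'C rot_r !source_side_dart (inj_eq inj_i).
move=> d; rewrite /face r'E rev_side_dart; set y := dart_rev _.
have yh : y \in codom side_dart by rewrite /y -rev_side_dart codom_f.
have dh := codom_f side_dart d.
have fy : face_off (side_dart d) = r y.
  by rewrite permM rev_offE; move: dh; rewrite codom_side_dart => /andP[/negPf ->].
have ry : r y \in codom side_dart = (r y \notin cut).
  move: yh; rewrite !codom_side_dart rotation_source // => /andP[_ ->].
  by rewrite andbT.
have ryy : r y \in cut -> r (r y) \notin cut.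
  move=> rC; apply/negP=> /(rot_cut rC) /perm_inj E.
  by move: yh; rewrite codom_side_dart -E rC.
have rryh : r y \in cut -> r (r y) \in codom side_dart.
  move=> rC; rewrite codom_side_dart (ryy rC) !rotation_source //.
  by move: yh; rewrite codom_side_dart => /andP[].
have dC : side_dart d \notin cut by move: dh; rewrite codom_side_dart => /andP[].
have kept x : x \in codom side_dart ->
    x \notin enum [pred t | t \notin codom side_dart].
  by move=> xh; rewrite mem_enum; apply/negPn.
(* A vertex has at most one cut dart, so at most one dart is left out at once. *)
have [rC|rC] := boolP (r y \in cut).
  rewrite (@skip_over _ r) ?kept ?rryh //; last by rewrite mem_enum inE ry rC.
  by rewrite skip_over ?mem_enum ?fy ?cut_succ // ryy.
by rewrite !skip_out ?kept ?mem_enum ?fy ?ry.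
Qed.

(** The face of the cut map that contains the half-edges of one side turns into
the outer face once these are deleted; each of them is represented by the dart
that follows it, which leaves from the same vertex. If the side is a single
vertex, no dart remains and the outer walk is trivial. *)
Lemma outer_embedding : exists E : plane_embedding K,
  subseq (map (@source H) (orbit cut_next c)) (map iota (pe_outer E)).
Proof.
have [r' [rot' sph' faceE]] := side_map.
have [x0 x0c] : exists x, source c = iota x by apply/side_i.
have [d0 _|noK] := pickP (@predT (dart K)); last first.
  have x0_only y : y = x0.
    have /connectP[[|z p] //= /andP[xz _] _] := conn_K x0 y.
    by have [d] := dart_of xz; have := noK d.
  have fw : facial_walk r' [:: x0] by right; exists x0.
  exists (PlaneEmbedding conn_K rot' sph' fw) => /=.
  have fc : face_off c = c.
    rewrite cut_succ //; apply: rot_cut => //; apply: contraT => rC.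
    have : r c \in codom side_dart by rewrite codom_side_dart rC rotation_source //=.
    by case/codomP=> d; have := noK d.
  have oc : orbit face_off c = [:: c].
    by rewrite (@orbitE _ _ [:: c]) //= ?fc ?eqxx // mem_head.
  by rewrite orbit_cut_next // oc /= cC /= x0c eqxx.
have rcC d : d \in cut -> side (source d) = side (source c) -> r d \notin cut.
  move=> dC /side_i[x dx].
  have [e ex] : exists e : dart K, source e = x.
    have [<-|ne] := eqVneq (source d0) x; first by exists d0.
    have /connectP[[|z p] /= ] := conn_K x (source d0).
      by move=> _ E; rewrite E eqxx in ne.
    by case/andP=> /dart_of[e ex _] _ _; exists e.
  apply/negP=> /(rot_cut dC) rd.
  have : fconnect r d (side_dart e) by rewrite rot_r source_side_dart ex dx.
  move/iter_findex; have -> n : iter n r d = d by elim: n => //= n ->.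
  by move=> E; have := codom_f side_dart e; rewrite -E codom_side_dart dC.
have /codomP[d1 d1E] : r c \in codom side_dart.
  by rewrite codom_side_dart rcC ?rotation_source /=.
have fw : facial_walk r' [seq source e | e <- orbit (face r') d1] by left; exists d1.
exists (PlaneEmbedding conn_K rot' sph' fw) => /=.
have inj_f : injective (face r').
  by move=> x y /perm_inj /(inv_inj (@dart_revK K)).
have [p op op'] := orbit_succ c (@perm_inj _ face_off).
have oE : map side_dart (orbit (face r') d1) = [seq d <- c :: p | d \notin cut].
  rewrite (orbit_map _ side_dart_inj inj_f (@perm_inj _ _) faceE) -d1E -(cut_succ cC).
  rewrite orbit_skip ?mem_enum ?cut_succ ?rcC // -(cut_succ cC) op'.
  rewrite filter_rcons mem_enum cC /= cC /=.
  by apply: eq_filter => d; rewrite mem_enum.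
set w := orbit (face r') d1 in oE *.
rewrite -map_comp -[X in subseq _ X](_ : map (@source H) (map side_dart w) = _).
  have side_p d : d \in c :: p -> side (source d) = side (source c).
    by rewrite -op -fconnect_orbit => /face_off_conn_side.
  have /= := cycle_orbit (@perm_inj _ face_off) c; rewrite op /= rcons_path.
  case/andP=> cp /eqP lc.
  rewrite oE orbit_cut_next // op; apply: subseq_shift cp _ => [d dp dC|].
    split; first by rewrite /= cut_succ // rcC // side_p.
    by rewrite cut_succ // rotation_source.
  apply/negP=> lC; have := rcC _ lC (side_p _ (mem_last _ _)).
  by rewrite -(cut_succ lC) lc cC.
by rewrite -map_comp.
Qed.

End SideGraph.

(** [pi] contracts the cut edges; parallel edges that arise are identified. *)
Section Contraction.
Variables (G : graph) (pi : H -> G).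
Hypothesis pi_side : forall u v, pi u = pi v -> side u = side v -> u = v.
Hypothesis pi_adj : forall u v, side u != side v -> (pi u == pi v) = adj u v.
Hypothesis adj_pi : forall x y, adj x y ->
  exists u v, [/\ adj u v, side u = side v, pi u = x & pi v = y].

(* With the faces kept and the cut edges split off the reversal, the rotation     *)
(* becomes [merged], which joins the two vertices of each cut edge.               *)
Let merged := (rev_on * r)%g.

Lemma genus0_contract : genus0 rev_off merged.
Proof.
have esV : rev_off^-1%g = rev_off.
  apply: (mulgI rev_off); rewrite mulgV; apply/permP=> d; rewrite perm1 permM (rev_offE d).
  case: ifPn => dC; first by rewrite rev_offE dC.
  by rewrite rev_offE cut_rev (negPf dC) dart_revK.
have rvV : (rev_perm H)^-1%g = rev_perm H.
  apply: (mulgI (rev_perm H)); rewrite mulgV; apply/permP=> d.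
  by rewrite perm1 permM !rev_permE dart_revK.
have := genus0_dual (proj1 (spherical_genus0 r) sph_r); rewrite rvV.
move/genus0_sym/(genus0_skip (enum cut))/genus0_sym; rewrite -/rev_off => /genus0_dual.
rewrite esV (_ : rev_off * _ = merged)%g // mulgA; congr (_ * _)%g.
apply/permP=> d; rewrite permM rev_permE rev_offE rev_onE; case: ifP => // _.
by rewrite dart_revK.
Qed.

Let symmerged := fconnect_sym (@perm_inj _ merged).

Let merged_cut n t c : c \in cut -> source c = source t ->
  iter n r t = c -> fconnect merged t c.
Proof.
move=> cC; elim: n t => [|n IHn] t ct; first by move=> /= ->; rewrite connect0.
rewrite iterSr => tn; have [tC|tC] := boolP (t \in cut).
  by rewrite (cut_uniq cC tC ct) connect0.
rewrite (same_fconnect1 (@perm_inj _ merged)) [merged t]permM rev_onE (negPf tC).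
by apply: IHn; rewrite // rotation_source.
Qed.

Let merged_source t t' : source t = source t' -> fconnect merged t t'.
Proof.
move=> tt'; have [c /andP[cC /eqP ct]|noc] := pickP [pred c in cut | source c == source t].
  have to_c u : source u = source t -> fconnect merged u c.
    move=> ut; have /iter_findex : fconnect r u c by rewrite rot_r ut ct.
    by apply: merged_cut; rewrite // ct ut.
  by apply: connect_trans (to_c t _) _; rewrite // symmerged to_c.
have : fconnect r t t' by rewrite rot_r tt'.
move/iter_findex <-; elim: findex => [|n IHn]; first by rewrite connect0.
apply: connect_trans IHn _; rewrite iterS; set u := iter n r t.
have ut : source u = source t by rewrite /u; elim: n @u => //= n; rewrite rotation_source.
apply/connect1/eqP; rewrite permM rev_onE ifN //.
by have := noc u; rewrite /= ut eqxx andbT => ->.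
Qed.

Lemma fconnect_contract t t' :
  fconnect merged t t' = (pi (source t) == pi (source t')).
Proof.
apply/idP/eqP => [|E].
  apply: (@fconnect_invariant _ _ _ (fun d => pi (source d))) => d.
  rewrite /invariant /= permM rotation_source // rev_onE.
  case: ifP => [|_]; last by rewrite eqxx.
  by rewrite inE eq_sym => dC; rewrite pi_adj // adj_sym dart_adj.
have [ss|ns] := eqVneq (side (source t)) (side (source t')).
by apply: merged_source; apply: pi_side.
have /dart_of[c ct ct'] : adj (source t) (source t') by rewrite -pi_adj // E.
apply: connect_trans (merged_source (esym ct)) _.
rewrite (same_fconnect1 (@perm_inj _ merged)); apply: merged_source.
by rewrite permM rotation_source // rev_onE inE ct ct' ns.
Qed.

(* The default value is never used for a vertex that has a preimage on side [b]. *)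
Let lift (b : bool) (x : G) : H :=
  odflt (source c0) [pick u | (pi u == x) && (side u == b)].

Let liftE u : lift (side u) (pi u) = u.
Proof.
rewrite /lift; case: pickP => /= [v /andP[/eqP piv /eqP sv]|/(_ u)].
  exact: pi_side.
by rewrite !eqxx.
Qed.

Let liftable b x := (pi (lift b x) == x) && (side (lift b x) == b).
(* An edge of [G] may come from an edge on each side; to choose the same preimage *)
(* for both of its darts, the side [true] is preferred.                           *)
Let edge_side (x y : G) :=
  [&& liftable true x, liftable true y & adj (lift true x) (lift true y)].

Let edge_lift x y : adj x y -> let b := edge_side x y in
  [&& liftable b x, liftable b y & adj (lift b x) (lift b y)].
Proof.
move=> xy /=; case bE: (edge_side x y) => //; move: xy => /adj_pi[u [v [uv suv ux vy]]].
have Lu : lift (side u) x = u by rewrite -ux liftE.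
have Lv : lift (side u) y = v by rewrite suv -vy liftE.
have : [&& liftable (side u) x, liftable (side u) y
         & adj (lift (side u) x) (lift (side u) y)].
  by rewrite /liftable Lu Lv ux vy uv suv !eqxx.
by case: (side u) => //; rewrite [X in is_true X]bE.
Qed.

Let edge_dart_proof (d : dart G) : let b := edge_side (val d).1 (val d).2 in
  adj (lift b (val d).1) (lift b (val d).2).
Proof. by have /and3P[] := edge_lift (valP d). Qed.

Let edge_dart d : dart H := exist _ (_, _) (edge_dart_proof d).

Let edge_dart_rev d : edge_dart (dart_rev d) = dart_rev (edge_dart d).
Proof.
apply: val_inj => /=.
rewrite (_ : edge_side (val d).2 _ = edge_side (val d).1 (val d).2) //.
by rewrite /edge_side adj_sym andbCA.
Qed.

Let edge_dart_pi d : pi (source (edge_dart d)) = source d.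
Proof. by have /and3P[/andP[/eqP]] := edge_lift (valP d). Qed.

Let edge_dart_cut d : edge_dart d \notin cut.
Proof.
have /and3P[/andP[_ /eqP E1] /andP[_ /eqP E2] _] := edge_lift (valP d).
by rewrite inE negbK [side (source _)]E1 [side (source (dart_rev _))]E2.
Qed.

Lemma contraction_planar : planar G.
Proof.
have inj_d : injective edge_dart.
  move=> d e E; apply: dart_eq; first by rewrite -!edge_dart_pi E.
  by rewrite -!edge_dart_pi !edge_dart_rev E.
have hE x : edge_dart (rev_perm G x) = rev_off (edge_dart x).
  by rewrite rev_permE rev_offE (negPf (edge_dart_cut x)) edge_dart_rev.
have [r' [plr' _ r'C]] := submap inj_d hE genus0_contract.
exists r'; split; last exact/spherical_genus0.
by move=> d e; rewrite r'C fconnect_contract !edge_dart_pi.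
Qed.

End Contraction.

End Cut.

(** * Partial cubes as distance-preserving labellings *)

Section Walks.
Variable G : graph.

Lemma walkP (x y : G) n :
  reflect (exists p, [/\ path adj x p, last x p = y & size p = n]) (walk x y n).
Proof.
apply: (iffP existsP) => [[p /andP[xp /eqP xy]]|[p [xp xy pn]]].
  by exists p; rewrite size_tuple.
have sp : size p == n by rewrite pn.
by exists (Tuple sp); rewrite xp xy eqxx.
Qed.

Lemma walk0 (x : G) : walk x x 0.
Proof. by apply/walkP; exists [::]. Qed.

Lemma walk_cons (x y z : G) n : adj x y -> walk y z n -> walk x z n.+1.
Proof.
move=> xy /walkP[p [yp yz pn]]; apply/walkP; exists (y :: p).
by rewrite /= xy yp yz pn.
Qed.

Lemma walk_cat (x y z : G) m n : walk x y m -> walk y z n -> walk x z (m + n).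
Proof.
move=> /walkP[p [xp xy pm]] /walkP[q [yq yz qn]]; apply/walkP; exists (p ++ q).
by rewrite cat_path last_cat size_cat xy xp yq yz pm qn.
Qed.

Lemma walk_connect (x y : G) n : walk x y n -> connect adj x y.
Proof. by case/walkP=> p [xp xy _]; apply/connectP; exists p. Qed.

Lemma dist_walk (x y : G) n : dist x y = Some n -> walk x y n.
Proof. by rewrite /dist; case: decP => // xy; case: ex_minnP => m xym _ [<-]. Qed.

Lemma dist_min (x y : G) n :
  walk x y n -> (forall m, walk x y m -> n <= m) -> dist x y = Some n.
Proof.
move=> xyn min; rewrite /dist; case: decP => [xy|]; last by move/(_ (walk_connect xyn)).
case: ex_minnP => m xym minm; congr Some; apply/eqP.
by rewrite eqn_leq minm ?min.
Qed.

End Walks.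

Lemma walk_map (G K : graph) (f : G -> K) x y n :
    (forall u v, adj u v -> adj (f u) (f v)) ->
  walk x y n -> walk (f x) (f y) n.
Proof.
move=> fadj /walkP[p [xp <- <-]]; apply/walkP; exists (map f p).
by rewrite last_map size_map path_map (sub_path _ xp).
Qed.

Definition hamming d (x y : {ffun 'I_d -> bool}) := #|[set i | x i != y i]|.

Section Hamming.
Variable d : nat.
Implicit Types x y z : {ffun 'I_d -> bool}.

Lemma hammingC x y : hamming x y = hamming y x.
Proof. by apply: eq_card => i; rewrite !inE eq_sym. Qed.

Lemma hamming_eq0 x y : (hamming x y == 0) = (x == y).
Proof.
rewrite cards_eq0; apply/eqP/eqP => [E|->]; last by apply/setP=> i; rewrite !inE eqxx.
apply/ffunP=> i; apply/eqP; have := in_set0 i; rewrite -E inE.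
by move/negbFE.
Qed.

Lemma hamming_tri x y z : hamming x z <= hamming x y + hamming y z.
Proof.
apply: leq_trans (leq_card_setU _ _); apply: subset_leq_card.
apply/subsetP=> i; rewrite !inE; apply: contraNT; rewrite negb_or !negbK.
by case/andP=> /eqP -> /eqP ->.
Qed.

Lemma cube_walk x y : walk (x : hypercube d) y (hamming x y).
Proof.
move E: (hamming x y) => n; elim: n x E => [|n IHn] x E.
  by move/eqP: E; rewrite hamming_eq0 => /eqP ->; exact: walk0.
have [i] : exists i, i \in [set i | x i != y i].
  by apply/set0Pn; rewrite -cards_eq0 -/(hamming x y) E.
rewrite inE => xyi.
pose x' : {ffun 'I_d -> bool} := [ffun j => if j == i then y j else x j].
apply: (@walk_cons _ (x : hypercube d) x').
  rewrite /= /cube_adj; apply/cards1P; exists i; apply/setP=> j; rewrite !inE ffunE.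
  by case: (eqVneq j i) => [->|]; rewrite ?xyi ?eqxx.
apply: IHn; have := cardsD1 i [set i | x i != y i]; rewrite inE xyi -/(hamming x y) E.
case=> ->; apply: eq_card => j; rewrite !inE ffunE.
by case: (eqVneq j i) => [->|]; rewrite ?eqxx.
Qed.

End Hamming.

(** The first condition makes labels a lower bound for distances, the second
makes them an upper bound. *)
Definition cube_embedding (G : graph) d (phi : G -> {ffun 'I_d -> bool}) :=
  (forall x y, adj x y -> hamming (phi x) (phi y) = 1) /\
  (forall x y, walk x y (hamming (phi x) (phi y))).

Section Embedding.
Variables (G : graph) (d : nat) (phi : G -> {ffun 'I_d -> bool}).
Hypothesis emb : cube_embedding phi.

Lemma hamming_le_walk x y n : walk x y n -> hamming (phi x) (phi y) <= n.
Proof.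
case/walkP=> p [xp <- <-]; elim: p x xp => [|z p IHp] x /=.
  by move=> _; rewrite leqn0 hamming_eq0.
case/andP=> /(proj1 emb) xz /IHp zp.
by apply: leq_trans (hamming_tri _ (phi z) _) _; rewrite xz.
Qed.

Lemma emb_dist x y : dist x y = Some (hamming (phi x) (phi y)).
Proof. by apply: dist_min; [apply: (proj2 emb)|move=> m; apply: hamming_le_walk]. Qed.

Lemma emb_inj : injective phi.
Proof.
move=> x y E; have := (proj2 emb) x y; rewrite E (_ : hamming _ _ = 0).
  by case/walkP=> p [_ <- /size0nil ->].
by apply/eqP; rewrite hamming_eq0.
Qed.

Lemma emb_adj x y : adj x y = (hamming (phi x) (phi y) == 1).
Proof.
apply/idP/eqP=> [/(proj1 emb) //|E]; have := (proj2 emb) x y; rewrite E.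
by case/walkP=> -[|z [|? ?]] [] //= /andP[xz _] <-.
Qed.

Lemma emb_connect (x y : G) : connect adj x y.
Proof. exact: walk_connect ((proj2 emb) x y). Qed.

Lemma isometricP (S : subgraph G) :
  isometric S <-> cube_embedding (fun x : graph_of S => phi (val x)).
Proof.
split=> [iso_S|[adjS walkS] x y].
  split=> x y; first by case/se_sub/and3P=> _ _ /(proj1 emb).
  by apply: dist_walk; rewrite iso_S emb_dist.
rewrite emb_dist; apply: dist_min (walkS x y) _ => m.
have incl (u v : graph_of S) : adj u v -> adj (val u) (val v).
  by case/se_sub/and3P.
by move/(walk_map incl)/hamming_le_walk.
Qed.

End Embedding.

Lemma cube_emb d : @cube_embedding (hypercube d) d id.
Proof. by split=> [x y /eqP //|x y]; apply: cube_walk. Qed.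

Section Induced.
Variables (K : graph) (A : {set K}).
Hypothesis A0 : A != set0.

Definition induced_se : rel K := fun x y => [&& x \in A, y \in A & adj x y].

Lemma induced_sym : symmetric induced_se.
Proof. by move=> x y; rewrite /induced_se adj_sym andbCA. Qed.

Lemma induced_sub x y : induced_se x y -> [&& x \in A, y \in A & adj x y].
Proof. by []. Qed.

Definition induced := Subgraph induced_sym induced_sub A0.

Lemma induced_adj (x y : graph_of induced) : adj x y = adj (val x) (val y).
Proof. by rewrite /= /sg_adj /= /induced_se !(valP x, valP y). Qed.

End Induced.

Lemma iso_refl G : iso G G.
Proof. by exists id; split=> //; exists id. Qed.

Lemma iso_sym G K : iso G K -> iso K G.
Proof.
case=> f [[g fK gK] fadj]; exists g; split=> [|x y]; first by exists f.
by rewrite -fadj !gK.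
Qed.

Lemma surj_bij (A B : finType) (f : A -> B) :
  injective f -> (forall y, exists x, y = f x) -> bijective f.
Proof.
move=> inj_f sur; apply: inj_card_bij => //.
rewrite -(card_codom inj_f); apply/subset_leq_card/subsetP=> y _.
by have [x ->] := sur y; apply: codom_f.
Qed.

Lemma partial_cubeP G :
  partial_cube G <-> exists d (phi : G -> {ffun 'I_d -> bool}), cube_embedding phi.
Proof.
split=> [[d [S [/(isometricP (cube_emb d)) [adjS walkS] [f [[g fK gK] fadj]]]]]|[d [phi emb]]].
  exists d, (fun x => val (f x)); split=> x y; first by rewrite -fadj => /adjS.
  have gadj u v : adj u v -> adj (g u) (g v) by rewrite -fadj !gK.
  by have := walk_map gadj (walkS (f x) (f y)); rewrite !fK.
pose A : {set hypercube d} := phi @: setT.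
have A0 : A != set0.
  have /card_gt0P[x _] := vertex_gt0 G.
  by apply/set0Pn; exists (phi x); rewrite imset_f.
have phiA x : phi x \in A by rewrite imset_f.
pose f (x : G) : graph_of (induced A0) := exist _ (phi x) (phiA x).
have fadj x y : adj (f x) (f y) = adj x y by rewrite induced_adj (emb_adj emb).
have fsur y : exists x, y = f x.
  by have /imsetP[x _ E] := valP y; exists x; apply: val_inj.
exists d, (induced A0); split; last first.
  exists f; split=> //; apply: surj_bij => // x y /(congr1 val) /= /(emb_inj emb).
  exact.
apply/(isometricP (cube_emb d)); split=> x y.
  by rewrite induced_adj => /eqP.
have [[u ->] [v ->]] := (fsur x, fsur y).
by apply: walk_map ((proj2 emb) u v) => u' v'; rewrite fadj.
Qed.

Lemma partial_cube_iso G K : iso G K -> partial_cube K -> partial_cube G.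
Proof.
case=> f [bf fadj] /partial_cubeP[d [phi [adjp walkp]]]; apply/partial_cubeP.
exists d, (fun x => phi (f x)); split=> x y; first by rewrite -fadj => /adjp.
have [g fK gK] := bf.
have gadj u v : adj u v -> adj (g u) (g v) by rewrite -fadj !gK.
by have := walk_map gadj (walkp (f x) (f y)); rewrite !fK.
Qed.

Definition ffcons d (b : bool) (x : {ffun 'I_d -> bool}) : {ffun 'I_d.+1 -> bool} :=
  [ffun i => if unlift ord0 i is Some j then x j else b].

Lemma hamming_ffcons d b b' (x y : {ffun 'I_d -> bool}) :
  hamming (ffcons b x) (ffcons b' y) = (b != b') + hamming x y.
Proof.
rewrite /hamming (cardsD1 ord0) inE !ffunE unlift_none; congr (_ + _).
rewrite -[RHS](card_imset _ (@lift_inj _ ord0)); apply: eq_card => i.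
rewrite !inE !ffunE; case: unliftP => [j ->|->] /=.
  by rewrite mem_imset ?inE //; exact: lift_inj.
by apply/esym/imsetP=> -[j _ /eqP]; rewrite (negPf (neq_lift _ _)).
Qed.

Section ExpansionCube.
Variables (G : graph) (G1 G2 : subgraph G).
Hypotheses (iso1 : isometric G1) (iso2 : isometric G2) (cov : edge_cover G1 G2).

(** The first vertex of the walk in [G2], if it is not the start, is reached along an
edge of [G1]. *)
Lemma crossing_walk (x y : G) n : x \in sv G1 -> y \in sv G2 -> walk x y n ->
  exists z m, [/\ z \in sv G1 :&: sv G2, walk x z m, walk z y (n - m) & m <= n].
Proof.
move=> x1 y2 /walkP[p [xp xy <-]] {n}; elim: p x x1 xp xy => [|w p IHp] x x1 /=.
  move=> _ xy; exists x, 0; rewrite inE x1 xy y2; split=> //; exact: walk0.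
case/andP=> xw wp wy; have [x2|nx2] := boolP (x \in sv G2).
  exists x, 0; rewrite inE x1 x2 subn0; split=> //; first exact: walk0.
  by apply/walkP; exists (w :: p); rewrite /= xw wp.
have w1 : w \in sv G1.
  case/orP: (cov.2 _ _ xw) => /se_sub /and3P[h1 h2 _] //.
  by rewrite h1 in nx2.
have [z [m [z12 wz zy mp]]] := IHp w w1 wp wy.
exists z, m.+1; split=> //; exact: walk_cons wz.
Qed.

(** A geodesic from one copy to the other is found by lifting a geodesic of [G]
and changing the copy at a common vertex. *)
Lemma expansion_cube : partial_cube G -> partial_cube (expansion_graph G1 G2).
Proof.
case/partial_cubeP=> d [phi emb]; apply/partial_cubeP.
have [adj1 walk1] := proj1 (isometricP emb G1) iso1.
have [adj2 walk2] := proj1 (isometricP emb G2) iso2.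
pose psi (u : expansion_graph G1 G2) : {ffun 'I_d.+1 -> bool} := match u with
  inl x => ffcons false (phi (val x)) | inr x => ffcons true (phi (val x)) end.
have cross (x : graph_of G1) (y : graph_of G2) :
    walk (inl x : expansion_graph G1 G2) (inr y) (hamming (phi (val x)) (phi (val y))).+1.
  have [z [m [z12 xz zy mn]]] := crossing_walk (valP x) (valP y) (proj2 emb _ _).
  have [z1 z2] := setIP z12.
  pose za : graph_of G1 := exist _ z z1; pose zb : graph_of G2 := exist _ z z2.
  have W1 : walk x za (hamming (phi (val x)) (phi z)) := walk1 x za.
  have W2 : walk zb y (hamming (phi z) (phi (val y))) := walk2 zb y.
  have tri := hamming_tri (phi (val x)) (phi z) (phi (val y)).
  have xzm := hamming_le_walk emb xz; have zym := hamming_le_walk emb zy.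
  have -> : (hamming (phi (val x)) (phi (val y))).+1 =
            hamming (phi (val x)) (phi z) + (hamming (phi z) (phi (val y))).+1.
    by move: tri xzm zym mn; move: (hamming _ _) (hamming _ _) (hamming _ _); lia.
  apply: (@walk_cat _ _ (inl za : expansion_graph G1 G2)); first exact: walk_map W1.
  apply: (@walk_cons _ _ (inr zb : expansion_graph G1 G2)); first exact: eqxx.
  exact: walk_map W2.
have walk_sym (u v : expansion_graph G1 G2) n : walk u v n -> walk v u n.
  case/walkP=> p [up <- <-]; apply/walkP; exists (rev (belast u p)).
  rewrite size_rev size_belast rev_path (eq_path (e' := adj)); last first.
    by move=> *; exact: adj_sym.
  by split=> //; case: p {up} => //= a p; rewrite rev_cons last_rcons.
exists d.+1, psi; split=> -[x|x] [y|y] //=; rewrite ?hamming_ffcons ?add0n ?add1n.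
- exact: adj1.
- by move/eqP ->; congr _.+1; apply/eqP; rewrite hamming_eq0.
- by move/eqP ->; congr _.+1; apply/eqP; rewrite hamming_eq0.
- exact: adj2.
- by apply: walk_map (walk1 x y).
- exact: cross.
- by apply: walk_sym; rewrite hammingC; apply: cross.
by apply: walk_map (walk2 x y).
Qed.

End ExpansionCube.

(** * Contracting a coordinate of a partial cube *)

Section Contract.
Variables (H : graph) (d : nat) (phi : H -> {ffun 'I_d -> bool}) (i0 : 'I_d).
Hypothesis emb : cube_embedding phi.
Let side : pred H := fun u => phi u i0.
Hypothesis sides : forall b, exists u, side u = b.

(** The coordinate is reset rather than removed, so that words keep their
length. *)
Definition forget (x : {ffun 'I_d -> bool}) : {ffun 'I_d -> bool} :=
  [ffun i => (i != i0) && x i].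

Lemma hamming_forget u v : hamming (phi u) (phi v) =
  (side u != side v) + hamming (forget (phi u)) (forget (phi v)).
Proof.
rewrite {1}/hamming (cardsD1 i0) inE; congr (_ + _); apply: eq_card => i.
by rewrite !inE !ffunE; case: (i == i0).
Qed.

Definition contract_set : {set hypercube d} := [set forget (phi u) | u in setT].

Lemma contract_set_neq0 : contract_set != set0.
Proof.
have [u _] := sides true; apply/set0Pn; exists (forget (phi u)).
by apply: imset_f.
Qed.

Definition contract := graph_of (induced contract_set_neq0).

Lemma forget_in u : forget (phi u) \in contract_set. Proof. by apply: imset_f. Qed.

Definition proj (u : H) : contract :=
  exist (fun x => x \in contract_set) (forget (phi u)) (forget_in u).

Lemma proj_sur x : exists u, x = proj u.
Proof. by have /imsetP[u _ E] := valP x; exists u; apply: val_inj. Qed.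

Lemma contract_adj (x y : contract) : adj x y = (hamming (val x) (val y) == 1).
Proof. exact: induced_adj. Qed.

Lemma proj_side u v : proj u = proj v -> side u = side v -> u = v.
Proof.
move=> /(congr1 val) /= puv suv; apply: (emb_inj emb); apply/eqP.
by rewrite -hamming_eq0 hamming_forget suv eqxx puv hamming_eq0 eqxx.
Qed.

Lemma proj_adj u v : side u != side v -> (proj u == proj v) = adj u v.
Proof.
by move=> suv; rewrite (emb_adj emb) hamming_forget suv eqSS hamming_eq0.
Qed.

Lemma adj_same u v : side u = side v -> adj u v = adj (proj u) (proj v).
Proof.
by move=> suv; rewrite contract_adj (emb_adj emb) hamming_forget suv eqxx.
Qed.

(** A step along the coordinate [i0] becomes a pause. *)
Lemma lazy_walk u v n : walk u v n ->
  exists2 m, walk (proj u) (proj v) m & m + (side u != side v) <= n.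
Proof.
case/walkP=> p [up <- <-]; elim: p u up => [|w p IHp] u /=.
  by exists 0; rewrite ?eqxx //; apply: walk0.
case/andP=> uw /IHp[m wv mn]; have [suw|suw] := eqVneq (side u) (side w).
  exists m.+1; last by rewrite suw addSn ltnS.
  by apply: walk_cons wv; rewrite -adj_same.
exists m; first by move: uw; rewrite -proj_adj // => /eqP ->.
have : (side u != side (last w p)) <= (side w != side (last w p)).+1 by case: eqP.
by move: mn; lia.
Qed.

(** A geodesic of [H] projects to a walk of the right length, since it takes
as many steps along [i0] as the Hamming distance loses. *)
Lemma contract_emb : cube_embedding (fun x : contract => val x).
Proof.
have adjP (x y : contract) : adj x y -> hamming (val x) (val y) = 1.
  by rewrite contract_adj => /eqP.
split=> // x y; have [[u ->] [v ->]] := (proj_sur x, proj_sur y).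
have [m W le_m] := lazy_walk ((proj2 emb) u v); rewrite hamming_forget addnC in le_m.
rewrite leq_add2l in le_m.
suff -> : hamming (val (proj u)) (val (proj v)) = m by [].
apply/eqP; rewrite eqn_leq le_m andbT.
have /walkP[p [up <- <-]] := W.
elim: p (proj u) up => [|w p IHp] x' /=; first by rewrite leqn0 hamming_eq0.
case/andP=> /adjP xw /IHp le_p.
by apply: leq_trans (hamming_tri _ (val w) _) _; rewrite xw.
Qed.

Lemma contract_partial_cube : partial_cube contract.
Proof. by apply/partial_cubeP; exists d, (fun x => val x); apply: contract_emb. Qed.

(** Leaving the side would cost a step that does not approach the target in any
other coordinate. *)
Lemma side_geodesic u p : path adj u p -> side u = side (last u p) ->
    size p = hamming (phi u) (phi (last u p)) ->
  path (fun v w => adj v w && (side v == side w)) u p.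
Proof.
elim: p u => //= w p IHp u /andP[uw wp] suv sz; rewrite uw.
have le_p : hamming (phi w) (phi (last w p)) <= size p.
  by apply: hamming_le_walk => //; apply/walkP; exists p.
have [suw|suw] := eqVneq (side u) (side w).
  rewrite /= IHp -?suw //; apply/eqP; rewrite eqn_leq le_p andbT.
  have := hamming_tri (phi u) (phi w) (phi (last w p)).
  by rewrite -sz ((proj1 emb) _ _ uw); lia.
have /(congr1 val) /= puw : proj u = proj w by apply/eqP; rewrite proj_adj.
move: le_p; rewrite -ltnS sz !hamming_forget -suv puw.
by rewrite eqxx [side w == _]eq_sym (negPf suw) ltnNge leq_addl.
Qed.

Lemma conn_side u v : side u = side v ->
  connect (fun v w => adj v w && (side v == side w)) u v.
Proof.
move=> suv; have /walkP[p [up uv sz]] := (proj2 emb) u v.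
apply/connectP; exists p => //; apply: side_geodesic; rewrite ?uv //.
Qed.

Definition side_set b : {set contract} :=
  [set x | [exists u, (side u == b) && (proj u == x)]].

Lemma side_setP b x : reflect (exists2 u, side u = b & proj u = x) (x \in side_set b).
Proof.
rewrite inE; apply: (iffP existsP) => [[u /andP[/eqP su /eqP ux]]|[u su ux]].
  by exists u.
by exists u; rewrite su ux !eqxx.
Qed.

Lemma side_set_neq0 b : side_set b != set0.
Proof.
by have [u su] := sides b; apply/set0Pn; exists (proj u); apply/side_setP; exists u.
Qed.

Definition side_sub b : subgraph contract := induced (side_set_neq0 b).

Lemma side_lift_proof b (x : graph_of (side_sub b)) :
  exists u, (side u == b) && (proj u == val x).
Proof. by have /side_setP[u su ux] := valP x; exists u; rewrite su ux !eqxx. Qed.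

Definition side_lift b (x : graph_of (side_sub b)) : H := xchoose (side_lift_proof x).

Lemma side_of_lift b x : side (@side_lift b x) = b.
Proof. by have /andP[/eqP] := xchooseP (side_lift_proof x). Qed.

Lemma proj_side_lift b x : proj (@side_lift b x) = val x.
Proof. by have /andP[_ /eqP] := xchooseP (side_lift_proof x). Qed.

Lemma side_lift_sur b u : side u = b -> exists x, u = @side_lift b x.
Proof.
move=> su; have ub : proj u \in side_set b by apply/side_setP; exists u.
exists (exist (fun x => x \in side_set b) (proj u) ub).
by apply: proj_side; rewrite ?proj_side_lift ?side_of_lift.
Qed.

Lemma side_lift_inj b : injective (@side_lift b).
Proof. by move=> x y E; apply: val_inj; rewrite -!proj_side_lift E. Qed.

Lemma adj_side_lift b x y : adj (@side_lift b x) (@side_lift b y) = adj x y.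
Proof. by rewrite adj_same ?side_of_lift // !proj_side_lift [RHS]induced_adj. Qed.

Lemma side_sub_emb b : cube_embedding (fun x : graph_of (side_sub b) => val (val x)).
Proof.
split=> [x y|x y]; first by rewrite induced_adj => /(proj1 contract_emb).
have xE : forget (phi (side_lift x)) = val (val x) by rewrite -proj_side_lift.
have yE : forget (phi (side_lift y)) = val (val y) by rewrite -proj_side_lift.
have := (proj2 emb) (side_lift x) (side_lift y).
rewrite hamming_forget !side_of_lift eqxx /= add0n xE yE => /walkP[p [xp xy sz]].
have sp : path (fun v w => adj v w && (side v == side w)) (side_lift x) p.
  apply: side_geodesic; rewrite // ?xy ?side_of_lift //.
  by rewrite hamming_forget !side_of_lift eqxx xE yE.
apply/walkP; move: sz; move: (hamming _ _) => n.
elim: p n x xp xy sp xE {yE} => [|w p IHp] n x /=.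
  by move=> _ /side_lift_inj <- _ _ <-; exists [::].
case/andP=> xw wp wy /andP[/andP[_ /eqP sxw] sp] xE <-.
have [x' wE] : exists x', w = @side_lift b x'.
  by apply: side_lift_sur; rewrite -sxw side_of_lift.
rewrite {}wE in xw wp wy sp.
have [q [x'q qy qs]] := IHp _ _ wp wy sp (congr1 val (proj_side_lift x')) erefl.
by exists (x' :: q); rewrite /= qy qs x'q -[X in X && _]/(adj x x') -adj_side_lift xw.
Qed.

Lemma side_sub_isometric b : isometric (side_sub b).
Proof. exact/(isometricP contract_emb)/side_sub_emb. Qed.

(** Adjacent words whose preimages lie on different sides have preimages at
distance two, and the middle vertex of a geodesic provides an edge within one of
the sides. *)
Lemma contract_edge (x y : contract) : adj x y ->
  exists u v, [/\ adj u v, side u = side v, proj u = x & proj v = y].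
Proof.
have [[u ->] [v ->]] := (proj_sur x, proj_sur y).
have [suv|suv] := eqVneq (side u) (side v).
  by exists u, v; rewrite adj_same // suv.
rewrite contract_adj => /eqP E.
have := (proj2 emb) u v; rewrite hamming_forget suv [hamming _ _]E.
case/walkP=> -[|w [|v' [|? ?]]] [] //= /and3P[uw wv _] Ev _; rewrite {}Ev in wv.
have [suw|suw] := eqVneq (side u) (side w).
  exists u, w; split=> //; apply/eqP; rewrite proj_adj //.
  by rewrite -suw.
exists w, v; split=> //.
  by move: suv suw; case: (side u); case: (side v); case: (side w).
by apply/eqP; rewrite proj_adj 1?eq_sym // adj_sym.
Qed.

Lemma side_sub_cover : edge_cover (side_sub false) (side_sub true).
Proof.
split=> [x|x y /contract_edge[u [v [uv suv <- <-]]]].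
  have [u ->] := proj_sur x; case su: (side u); apply/orP; [right|left];
    by apply/side_setP; exists u.
have us : proj u \in side_set (side u) by apply/side_setP; exists u.
have vs : proj v \in side_set (side u) by apply/side_setP; exists v.
have : se (side_sub (side u)) (proj u) (proj v).
  by rewrite /= /induced_se us vs -adj_same.
by case: (side u) => ->; rewrite ?orbT.
Qed.

Lemma contract_iso : iso H (expansion_graph (side_sub false) (side_sub true)).
Proof.
apply: iso_sym; pose f (x : expansion_graph (side_sub false) (side_sub true)) :=
  match x with inl x => side_lift x | inr x => side_lift x end.
exists f; split.
  apply: surj_bij => [|u].
    move=> [x|x] [y|y] /= E; first by rewrite (side_lift_inj E).
    - by have := side_of_lift x; rewrite E side_of_lift.
    - by have := side_of_lift x; rewrite E side_of_lift.
    by rewrite (side_lift_inj E).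
  case su: (side u); have [x ->] := side_lift_sur su; [by exists (inr x)|by exists (inl x)].
case=> [x|x] [y|y]; rewrite /= ?adj_side_lift //.
  by rewrite -proj_adj ?side_of_lift // !proj_side_lift.
by rewrite -proj_adj ?side_of_lift // !proj_side_lift eq_sym.
Qed.

Lemma cut_edge : exists u v, [/\ adj u v, side u = false & side v = true].
Proof.
have [[u su] [v sv]] := (sides false, sides true).
have /connectP[p up vE] := emb_connect emb u v; rewrite {}vE in sv.
elim: p u su up sv => [|w p IHp] u su /=; first by rewrite su.
case/andP=> uw wp; case sw: (side w); last exact: IHp.
by exists u, w.
Qed.

Lemma card_contract : #|contract| < #|H|.
Proof.
have [u [v [uv su sv]]] := cut_edge.
have suv : side u != side v by rewrite su sv.
have puv : proj u = proj v by apply/eqP; rewrite proj_adj.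
have -> : #|contract| = #|proj @: [set~ u]|.
  rewrite -cardsT; apply: eq_card => x; rewrite inE; apply/esym/imsetP.
  have [w ->] := proj_sur x; have [->|wu] := eqVneq w u.
    exists v; rewrite ?puv // !inE; apply/eqP=> E.
    by rewrite E eqxx in suv.
  by exists w; rewrite // !inE wu.
apply: leq_ltn_trans (leq_imset_card _ _) _; rewrite -[#|H|]cardsT.
apply: proper_card; apply/properP; split; first exact: subsetT.
by exists u; rewrite !inE // eqxx.
Qed.

Section Planar.
Variable r : {perm dart H}.
Hypotheses (rot_r : rotation_system r) (sph_r : spherical r).

Lemma cut_uniq c c' : c \in cut side -> c' \in cut side ->
  source c = source c' -> c = c'.
Proof.
move=> cC c'C E; apply: dart_eq => //; move: (dart_adj c) (dart_adj c').
move: cC c'C; rewrite !inE -E => cC c'C; rewrite -!proj_adj // => /eqP E1 /eqP E2.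
apply: proj_side; first by rewrite -E1 E2.
by move: cC c'C; do 3!case: (side _).
Qed.

Lemma contract_planar : planar contract.
Proof.
have [u [v [uv _ _]]] := cut_edge; have [c _ _] := dart_of uv.
apply: (contraction_planar rot_r sph_r cut_uniq c proj_side proj_adj contract_edge).
Qed.

Let corder (c : dart H) := [seq proj (source e) | e <- orbit (cut_next r side) c].

Lemma order_outer b c : c \in cut side -> side (source c) = b ->
  exists E : plane_embedding (graph_of (side_sub b)),
    outer_order E (sv (side_sub false) :&: sv (side_sub true)) (corder c).
Proof.
move=> cC cb.
have conn_half (x y : graph_of (side_sub b)) : connect adj x y.
  exact: emb_connect (side_sub_emb b) x y.
have side_i u : side u = side (source c) <-> exists x, u = @side_lift b x.
  by rewrite cb; split=> [|[x ->]]; [apply: side_lift_sur | apply: side_of_lift].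
have [E sub] := outer_embedding rot_r sph_r cut_uniq (@side_lift_inj b)
  (@adj_side_lift b) conn_half cC side_i.
have memP e := mem_orbit_cut_next rot_r sph_r (emb_connect emb) conn_side cC e cC.
exists E; split.
- rewrite map_inj_in_uniq ?orbit_uniq // => e e'; rewrite !memP.
  case/andP=> rev_on /eqP rev_off /andP[e'C /eqP e's] E1.
  by apply: cut_uniq => //; apply: proj_side; rewrite // rev_off e's.
- move=> x; rewrite inE; apply/mapP/andP.
    case=> e; rewrite memP => /andP[rev_on _] ->.
    have := rev_on; rewrite inE => rev_off.
    have Ee : proj (source e) = proj (source (dart_rev e)).
      by apply/eqP; rewrite proj_adj // dart_adj.
    split; apply/side_setP; move: rev_off; case se: (side (source e));
      case st: (side (source (dart_rev e))) => // _;
      by [exists (source e)|exists (source (dart_rev e))].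
  case=> /side_setP[u su ux] /side_setP[v sv vx].
  have uv : adj u v by rewrite -proj_adj ?su ?sv // ux vx.
  have vu : adj v u by rewrite adj_sym.
  have [[e eu ev] [e' e'v e'u]] := (dart_of uv, dart_of vu).
  exists (if b then e' else e); last by case: (b); rewrite ?e'v ?eu ?ux ?vx.
  by rewrite memP inE cb; case: (b); rewrite ?e'v ?e'u ?eu ?ev su sv.
exists 0; rewrite rot0; have := map_subseq proj sub; rewrite -!map_comp.
suff -> : map (proj \o @side_lift b) (pe_outer E) = map val (pe_outer E) by [].
by apply: eq_map => x; rewrite /= proj_side_lift.
Qed.

Lemma side_sub_noncrossing : noncrossing (side_sub false) (side_sub true).
Proof.
have [u [v [uv su sv]]] := cut_edge; have [c cu cv] := dart_of uv.
have cC : c \in cut side by rewrite inE cu cv su sv.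
have sc : side (source c) = false by rewrite cu.
have [E1 o1] := order_outer cC sc.
have sc' : side (source (rev_on side c)) = true by rewrite rev_on_side // sc.
have [E2 o2] := order_outer (rev_on_cut cC) sc'.
exists E1, E2, (corder c), (corder (rev_on side c)); split=> //.
have [i oE] := orbit_cut_next_rev rot_r sph_r (emb_connect emb) conn_side cC cC.
exists i; rewrite /corder oE map_rot map_rev -map_comp; congr (rot i (rev _)).
apply/eq_in_map => e.
rewrite (mem_orbit_cut_next rot_r sph_r (emb_connect emb) conn_side cC) //.
case/andP=> rev_on _ /=; rewrite rev_onE rev_on; apply/eqP; rewrite eq_sym.
by rewrite proj_adj ?dart_adj // rev_on.
Qed.

Lemma contract_expansion : noncrossing_2face_expansion contract H.
Proof.
split; first exact: contract_planar.
exists (side_sub false), (side_sub true); split; last exact: side_sub_noncrossing.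
split; [exact: side_sub_isometric|exact: side_sub_isometric
  |exact: side_sub_cover| |exact: contract_iso].
have [u [v [uv su sv]]] := cut_edge; apply/set0Pn; exists (proj u).
rewrite inE; apply/andP; split; apply/side_setP; first by exists u.
by exists v => //; apply/esym/eqP; rewrite proj_adj // su sv.
Qed.

End Planar.

End Contract.

(** * Marking corners of the outer face *)

(** A description of the darts of [G] by another finite type [T] is often easier
to build than permutations of the darts themselves. *)
Lemma planar_darts (G : graph) (T : finType) (src : T -> G) (e r : {perm T}) :
    involutive e -> (forall t, adj (src t) (src (e t))) ->
    (forall t t', src t = src t' -> src (e t) = src (e t') -> t = t') ->
    (forall x y, adj x y -> exists2 t, src t = x & src (e t) = y) ->
    (forall t t', fconnect r t t' = (src t == src t')) ->
  genus0 e r -> planar G.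
Proof.
move=> eK eadj einj esur rsrc per.
have ex (d : dart G) :
    exists t, (src t == source d) && (src (e t) == source (dart_rev d)).
  by have [t <- <-] := esur _ _ (dart_adj d); exists t; rewrite !eqxx.
pose h d := xchoose (ex d).
have h1 d : src (h d) = source d by have /andP[/eqP] := xchooseP (ex d).
have h2 d : src (e (h d)) = source (dart_rev d).
  by have /andP[_ /eqP] := xchooseP (ex d).
have inj_h : injective h.
  by move=> d d' E; apply: dart_eq; [rewrite -!h1 E | rewrite -!h2 E].
have he d : h (rev_perm G d) = e (h d).
  by rewrite rev_permE; apply: einj; rewrite ?eK ?h1 ?h2 ?dart_revK ?h1.
have [r' [plr' _ r'C]] := submap inj_h he per.
exists r'; split; last exact/spherical_genus0.
by move=> d d'; rewrite r'C rsrc !h1.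
Qed.

Lemma planar_iso G K : iso G K -> planar K -> planar G.
Proof.
case=> f [[g fK gK] fadj] [r [rot_r /spherical_genus0 sph_r]].
apply: (@planar_darts _ _ (fun d : dart K => g (source d)) (rev_perm K) r _ _ _ _ _ sph_r).
- by move=> d; rewrite !rev_permE dart_revK.
- by move=> d; rewrite -fadj !gK rev_permE dart_adj.
- move=> d d' /(can_inj gK) E /(can_inj gK); rewrite !rev_permE.
  exact: dart_eq.
- move=> x y; rewrite -fadj => /dart_of[d dx dy].
  by exists d; rewrite ?rev_permE ?dx ?dy fK.
by move=> d d'; rewrite rot_r (inj_eq (can_inj gK)).
Qed.

Lemma fcard_src (T V : finType) (src : T -> V) (a : {perm T}) :
    (forall t t', fconnect a t t' = (src t == src t')) ->
    (forall x, exists t, src t = x) ->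
  fcard a T = #|V|.
Proof.
move=> aug_source sur; have sur' x : exists t, src t == x.
  by have [t <-] := sur x; exists t.
pose s x := xchoose (sur' x).
have sK : cancel s src by move=> x; apply/eqP; exact: (xchooseP (sur' x)).
have sym := fconnect_sym (@perm_inj _ a).
rewrite -(card_codom (can_inj sK)); apply/eqP; rewrite eqn_leq; apply/andP; split.
  apply: (n_comp_le_cover sym) => // t _; exists (s (src t)); first exact: codom_f.
  by rewrite aug_source sK.
apply: (n_comp_ge_indep sym) => // _ _ /codomP[x ->] /codomP[y ->].
by rewrite aug_source !sK => /eqP ->.
Qed.

Lemma fcard_preim (D T : finType) (h : D -> T) (f : {perm T}) (f' : D -> D) (a : {pred T}) :
    injective h -> injective f' -> {subset a <= codom h} ->
    (forall x, h x \in a -> f (h x) = h (f' x)) -> fclosed f a ->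
  fcard f a = fcard f' [preim h of a].
Proof.
move=> inj_h inj_f' sub fh cl.
have sym := fconnect_sym (@perm_inj _ f); have sym' := fconnect_sym inj_f'.
apply: (adjunction_n_comp h sym sym' cl); apply: (strict_adjunction sym' cl) => //.
  by apply/subsetP.
by move=> x y /=; move/negPn => /fh ->; rewrite (inj_eq inj_h).
Qed.

Lemma n_comp_darts (K : graph) (r : {perm dart K}) (d : dart K) :
    rotation_system r -> (forall x y : K, connect adj x y) ->
  n_comp (glink (rev_perm K) r) (dart K) = 1.
Proof. by move=> rot conn; exact: n_comp_connected rot conn d. Qed.

(** One half-edge is attached to each of the vertices [iota c], before the selected
occurrence of that vertex on the outer walk. Half-edges are fixed by the
reversal of darts, and they stay when the graph is a single vertex, so this case
needs no separate treatment later. *)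
Section Augment.
Variables (K : graph) (C : finType) (iota : C -> K) (E : plane_embedding K).
Variables (l : seq C) (k : nat).
Hypotheses (inj_i : injective iota) (Ul : uniq l) (lC : forall c, c \in l).
Hypothesis l_outer : subseq (map iota l) (rot k (pe_outer E)).
Variable c0 : C.

Local Notation U := (dart K + C)%type.

Definition aug_source (u : U) : K := match u with inl d => source d | inr c => iota c end.

Definition aug_rev_fun (u : U) : U :=
  match u with inl d => inl (dart_rev d) | inr c => inr c end.

Lemma aug_revK : involutive aug_rev_fun.
Proof. by case=> //= d; rewrite dart_revK. Qed.

Definition aug_rev : {perm U} := perm (inv_inj aug_revK).

Definition is_mark (u : U) : bool := match u with inl _ => false | inr _ => true end.

(** The last clause is Euler's formula for a connected plane graph, with the outer
face, now the only face that carries half-edges, left out. *)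
Definition augmented (r : {perm U}) := let f := (aug_rev * r)%g in
  [/\ forall u u', fconnect r u u' = (aug_source u == aug_source u'),
      forall c, exists j, filter is_mark (orbit f (inr c)) = map inr (rot j l) &
      #|K| + fcard f [pred u | [forall c, ~~ fconnect f u (inr c)]]
        = fcard (@dart_rev K) (dart K) + 1].

Lemma augment_trivial (x : K) : (forall y : K, y = x) -> exists r, augmented r.
Proof.
move=> all_x; exists 1%g.
have nodart (d : dart K) : False.
  by have := dart_adj d; rewrite (all_x (source d)) (all_x (source _)) adj_irr.
have c_eq (c c' : C) : c = c' by apply: inj_i; rewrite !(all_x (iota _)).
have u_eq (u : U) : u = inr c0.
  by case: u => [d|c]; [case: (nodart d) | rewrite (c_eq c c0)].
split=> [u u'|c|]; first by rewrite (u_eq u) (u_eq u') connect0 eqxx.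
  exists 0; rewrite rot0 mulg1 (c_eq c c0).
  have -> : orbit aug_rev (inr c0) = [:: inr c0].
    by rewrite (@orbitE _ _ [:: inr c0]) //= ?permE ?mem_head // eqxx.
  case: l Ul (lC c0) => [|c1 [|c2 l']] //=; first by rewrite (c_eq c1 c0).
  by rewrite (c_eq c1 c2) inE eqxx.
rewrite (eq_card (B := pred1 x)) ?card1; last by move=> y; rewrite !inE (all_x y) eqxx.
rewrite [X in X + 1]eq_card0 ?add0n; last by move=> d; case: (nodart d).
rewrite [X in _ + X]eq_card0 // => u; rewrite !inE; apply/negbTE; rewrite negb_and.
by apply/orP; right; apply/negP=> /forallP/(_ c0); rewrite (u_eq u) connect0.
Qed.

Section NonTrivial.
Variable d0 : dart K.
Hypothesis outerE : pe_outer E = [seq source e | e <- orbit (face (pe_rot E)) d0].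

Let r0 := pe_rot E.
Let rot0 : rotation_system r0 := pe_rotation E.
Let o := rot k (orbit (face r0) d0).

Lemma face_inj (r : {perm dart K}) : injective (face r).
Proof. by move=> x y /perm_inj/(inv_inj (@dart_revK K)). Qed.

Let Uo : uniq o. Proof. by rewrite rot_uniq orbit_uniq. Qed.
Let cyc_o : fcycle (face r0) o.
Proof. by rewrite rot_cycle cycle_orbit //; apply: face_inj. Qed.

Lemma outer_darts : exists t,
  [/\ subseq t o, map (@source K) t = map iota l & size t = size l].
Proof.
have := l_outer; rewrite outerE -map_rot => /subseqP[m _].
rewrite -map_mask -/o => Et; exists (mask m o); split=> //.
  exact: mask_subseq.
by rewrite -(size_map (@source K)) -Et size_map.
Qed.

(** The selection of occurrences on the outer walk, as darts of that face. *)
Lemma corners : exists x : C -> dart K,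
  [/\ forall c, source (x c) = iota c & subseq (map x l) o].
Proof.
have [t [sub_t Et sz]] := outer_darts; pose x c := nth d0 t (index c l).
have xl : map x l = t.
  apply: (@eq_from_nth _ d0); rewrite size_map // => i il.
  by rewrite (nth_map c0) // /x index_uniq.
exists x; split=> [c|]; last by rewrite xl.
have il : index c l < size t by rewrite sz index_mem.
rewrite /x -(nth_map _ (source d0)) // Et (nth_map c0) ?nth_index // index_mem.
exact: lC.
Qed.

Section Corner.
Variable x : C -> dart K.
Hypotheses (corner_source : forall c, source (x c) = iota c) (sub_x : subseq (map x l) o).

Lemma corner_inj : injective x.
Proof. by move=> c c' E1; apply: inj_i; rewrite -!corner_source E1. Qed.

Definition mark (y : dart K) : option C := [pick c | x c == y].

Lemma mark_x c : mark (x c) = Some c.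
Proof.
by rewrite /mark; case: pickP => [c' /eqP/corner_inj ->|/(_ c)]; rewrite ?eqxx.
Qed.

Lemma markP y : match mark y with Some c => x c = y | None => forall c, x c != y end.
Proof. by rewrite /mark; case: pickP => [c /eqP|h c] //; rewrite h. Qed.

(** Composing a permutation with [swap] inserts each half-edge right before its
corner. *)
Definition swap (u : U) : U := match u with
  | inl y => if mark y is Some c then inr c else inl y
  | inr c => inl (x c) end.

Lemma swapK : involutive swap.
Proof.
case=> [y|c] /=; last by rewrite mark_x.
by case My: (mark y) (markP y) => [c|] /= => [->|]; rewrite ?My.
Qed.

Definition aug_rot_fun (u : U) : U :=
  match u with inl y => swap (inl (r0 y)) | inr c => inl (x c) end.

Lemma aug_rot_inj : injective aug_rot_fun.
Proof.
have E1 u : aug_rot_fun u = swap (match u with inl y => inl (r0 y) | inr c => inr c end).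
  by case: u.
move=> u v; rewrite !E1 => /(inv_inj swapK).
by case: u v => [y|c] [z|c'] // [E2]; rewrite -?E2 // (perm_inj E2).
Qed.

Definition aug_rot : {perm U} := perm aug_rot_inj.

Let f := (aug_rev * aug_rot)%g.

Lemma aug_face_inl y : f (inl y) = swap (inl (face r0 y)).
Proof. by rewrite permM !permE. Qed.

Lemma aug_face_inr c : f (inr c) = inl (x c).
Proof. by rewrite permM !permE. Qed.

Lemma aug_rot_source u u' : fconnect aug_rot u u' = (aug_source u == aug_source u').
Proof.
have sym := fconnect_sym (@perm_inj _ aug_rot).
have swap_src u1 : aug_source (swap u1) = aug_source u1.
  case: u1 => [y|c] /=; last by rewrite corner_source.
  by case: (mark y) (markP y) => [c <-|] //=; rewrite corner_source.
apply/idP/eqP.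
  apply: (@fconnect_invariant _ _ _ aug_source) => u1; apply/eqP; rewrite permE.
  case: u1 => [y|c]; last by rewrite /= corner_source.
  by rewrite /aug_rot_fun swap_src /= rotation_source.
have step y : fconnect aug_rot (inl y) (inl (r0 y)).
  have : aug_rot (inl y) = swap (inl (r0 y)) by rewrite permE.
  rewrite /=; case: (mark (r0 y)) (markP (r0 y)) => [c xc|_] E1; last first.
    by rewrite -E1 fconnect1.
  have E2 : aug_rot (inr c) = inl (r0 y) by rewrite permE /= xc.
  by rewrite -E2 -E1; apply: (fconnect_iter _ 2).
have inl_conn y z : source y = source z -> fconnect aug_rot (inl y) (inl z).
  move=> yz; have /iter_findex <- : fconnect r0 y z by rewrite rot0 yz.
  elim: findex => [|n IHn]; first exact: connect0.
  exact: connect_trans IHn (step _).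
have to_inl v : exists2 y, aug_source v = source y & fconnect aug_rot v (inl y).
  case: v => [y|c]; first by exists y; rewrite ?connect0.
  exists (x c); first by rewrite corner_source.
  by apply/connect1; rewrite /= permE.
have [[y uy cuy] [z uz cuz]] := (to_inl u, to_inl u').
rewrite uy uz => /inl_conn yz; apply: connect_trans cuy _.
by apply: connect_trans yz _; rewrite sym.
Qed.

(** What a dart of the outer face becomes on the face with half-edges. *)
Definition ins (y : dart K) : seq U :=
  if mark y is Some c then [:: inr c; inl y] else [:: inl y].

Lemma ins_path y p : fpath (face r0) y p ->
  fpath f (inl y) (flatten (map ins p)) /\
  last (inl y) (flatten (map ins p)) = inl (last y p).
Proof.
elim: p y => //= z p IHp y /andP[/eqP yz zp]; have [IH1 IH2] := IHp _ zp.
rewrite {1 3}/ins; case Mz: (mark z) (markP z) => [c|] xz /=.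
  by rewrite aug_face_inl yz /= Mz eqxx aug_face_inr xz eqxx IH1 IH2.
by rewrite aug_face_inl yz /= Mz eqxx IH1 IH2.
Qed.

Let o' := flatten (map ins o).

Lemma ins_cycle : fcycle f o'.
Proof.
have := cyc_o; rewrite (cycle_path d0) => /ins_path[P _].
rewrite (cycle_path (inl d0)) -/o' in P *.
suff -> : last (inl d0) o' = inl (last d0 o) by [].
rewrite /o'; case/lastP: (o) => [|p y] //=.
rewrite last_rcons map_rcons flatten_rcons last_cat /ins.
by case: (mark y).
Qed.

Lemma mem_ins p u : (u \in flatten (map ins p)) =
  match u with inl y => y \in p | inr c => x c \in p end.
Proof.
elim: p => [|z p IHp] /=; first by case: u.
rewrite mem_cat {}IHp /ins; case: (mark z) (markP z) => [c|] xz.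
  case: u => [y|c']; rewrite !inE //=.
  by rewrite -xz (inj_eq corner_inj) orbF.
by case: u => [y|c]; rewrite !inE //= (negPf (xz c)).
Qed.

Lemma ins_uniq : uniq o'.
Proof.
rewrite /o'; elim: (o) Uo => //= z p IHp /andP[zp /IHp Up].
rewrite cat_uniq Up andbT; apply/andP; split; first by rewrite /ins; case: mark.
apply/hasPn => u; rewrite mem_ins; apply: contraL => /=; rewrite /ins.
case: (mark z) (markP z) => [c|] xz; rewrite !inE; last by move/eqP->.
by case/orP=> /eqP -> //; rewrite xz.
Qed.

Lemma pmap_mark : pmap mark o = l.
Proof.
have xK : ocancel mark x by move=> y; case: (mark y) (markP y).
apply: (inj_map corner_inj); rewrite (pmap_filter xK).
have /subseq_uniqP/(_ sub_x) -> : uniq o := Uo.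
apply: eq_filter => y; case: (mark y) (markP y) => [c|] xy /=.
  by rewrite -xy map_f.
by apply/esym/mapP=> -[c _ yc]; have := xy c; rewrite yc eqxx.
Qed.

Lemma ins_marks : filter is_mark o' = map inr l.
Proof.
rewrite -{1}pmap_mark /o'; elim: (o) => //= z p IHp.
by rewrite filter_cat IHp /ins; case: (mark z).
Qed.

Lemma augment_corner : augmented aug_rot.
Proof.
have x_o c : x c \in o by apply: (mem_subseq sub_x); apply: map_f.
have conn c u : fconnect f u (inr c) = (u \in o').
  rewrite fconnect_sym; last exact: perm_inj.
  by rewrite (fconnect_cycle ins_cycle) // mem_ins.
split; first exact: aug_rot_source.
  move=> c; have co : inr c \in o' by rewrite mem_ins.
  have [i ->] := orbit_rot_cycle ins_cycle ins_uniq co.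
  exists (size (filter is_mark (take i o'))); rewrite map_rot -ins_marks.
  have -> : filter is_mark o' =
      filter is_mark (take i o') ++ filter is_mark (drop i o').
    by rewrite -filter_cat cat_take_drop.
  by rewrite rot_size_cat /rot filter_cat.
rewrite -/f; pose X : {pred U} := [pred u | [forall c, ~~ fconnect f u (inr c)]].
rewrite -/X.
have XE u : (u \in X) = (u \notin o').
  rewrite inE; apply/forallP/idP => [/(_ c0)|uo c]; by rewrite conn.
have symf := fconnect_sym (@perm_inj _ f).
have symF := fconnect_sym (@face_inj r0).
have -> : fcard f X = fcard (face r0) [predC fconnect (face r0) d0].
  rewrite (@fcard_preim _ _ inl _ (face r0)) //.
  - apply: eq_n_comp_r => y; rewrite [LHS]XE mem_ins mem_rot.
    by rewrite -fconnect_orbit.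
  - by move=> y z [].
  - exact: face_inj.
  - by case=> [y|c]; rewrite ?codom_f // XE mem_ins x_o.
  - move=> y; rewrite XE mem_ins => yo; rewrite aug_face_inl /=.
    case: (mark _) (markP (face r0 y)) => // c xc; case/negP: yo.
    have := x_o c; rewrite xc !mem_rot -!fconnect_orbit.
    by rewrite -(same_fconnect1_r (@face_inj r0)).
  move=> u v /= uv; rewrite !XE -!(conn c0); congr (~~ _).
  by rewrite (same_fconnect1 (@perm_inj _ f) u) (eqP uv).
have S := proj1 (spherical_genus0 r0) (pe_spherical E).
rewrite /genus0 /euler_count /euler_bound (n_comp_darts d0 rot0 (@pe_connected _ E)) in S.
have S1 : fcard r0 (dart K) = #|K|.
  apply: fcard_src rot0 _ => y; have [->|ne] := eqVneq y (source d0).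
    by exists d0.
  have /connectP[[|z p] /=] := pe_connected E y (source d0).
    by move=> _ E1; rewrite E1 eqxx in ne.
  by case/andP=> /dart_of[d dy _] _ _; exists d.
have S3 : fcard (rev_perm K * r0)%g (dart K) =
    1 + fcard (face r0) [predC fconnect (face r0) d0].
  rewrite -[LHS](eq_fcard (@face_perm _ r0)).
  by rewrite (n_compC (fconnect (face r0) d0)) n_comp_connect.
move: S; rewrite S1 S3 card_dart fcard_rev_perm.
by move: (n_comp_mem _ _) (n_comp_mem _ _) => a b; lia.
Qed.

End Corner.
End NonTrivial.

Lemma augment : exists r, augmented r.
Proof.
case: (pe_facial E) => [[d0 outerE]|[x _ all_x]]; last exact: augment_trivial all_x.
have [x [corner_source sub_x]] := corners outerE.
by exists (aug_rot corner_source); apply: augment_corner sub_x.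
Qed.

End Augment.

(** * Gluing two marked plane graphs *)

(** The two copies are marked in opposite orders [l] and [rot k (rev l)], and
corresponding half-edges are joined to edges, the bridges. *)
Section Glue.
Variables (G : graph) (G1 G2 : subgraph G).
Let K1 := graph_of G1.
Let K2 := graph_of G2.
Let H := expansion_graph G1 G2.
Definition common : finType := {x : G | (x \in sv G1) && (x \in sv G2)}.
Local Notation C := common.

Lemma common1 (c : C) : val c \in sv G1. Proof. by have /andP[] := valP c. Qed.
Lemma common2 (c : C) : val c \in sv G2. Proof. by have /andP[] := valP c. Qed.

Definition in1 (c : C) : K1 := exist (fun x => x \in sv G1) (val c) (common1 c).
Definition in2 (c : C) : K2 := exist (fun x => x \in sv G2) (val c) (common2 c).

Lemma in1_inj : injective in1. Proof. by move=> c c' /(congr1 val) /= /val_inj. Qed.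
Lemma in2_inj : injective in2. Proof. by move=> c c' /(congr1 val) /= /val_inj. Qed.

Local Notation U1 := (dart K1 + C)%type.
Local Notation U2 := (dart K2 + C)%type.
Local Notation T := (U1 + U2)%type.
Local Notation TF := ((U1 + U2)%type : finType).

Variables (l : seq C) (k : nat) (c0 : C) (r1 : {perm U1}) (r2 : {perm U2}).
Hypotheses (Ul : uniq l) (lC : forall c, c \in l).
Hypothesis aug1 : augmented in1 l r1.
Hypothesis aug2 : augmented in2 (rot k (rev l)) r2.
Hypothesis conn_H : forall x y : H, connect adj x y.
Hypothesis conn_1 : forall x y : K1, connect adj x y.
Hypothesis conn_2 : forall x y : K2, connect adj x y.

Let f1 := (aug_rev K1 C * r1)%g.
Let f2 := (aug_rev K2 C * r2)%g.

Definition glue_source (t : T) : H :=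
  match t with inl u => inl (aug_source in1 u) | inr u => inr (aug_source in2 u) end.

Definition sum_fun (g1 : U1 -> U1) (g2 : U2 -> U2) (t : T) : T :=
  match t with inl u => inl (g1 u) | inr u => inr (g2 u) end.

Lemma sum_inj (g1 : {perm U1}) (g2 : {perm U2}) : injective (sum_fun g1 g2).
Proof. by move=> [u|u] [v|v] // [/perm_inj ->]. Qed.

Definition sum_perm g1 g2 : {perm T} := perm (@sum_inj g1 g2).

Lemma sum_permM g1 g2 h1 h2 :
  (sum_perm g1 g2 * sum_perm h1 h2)%g = sum_perm (g1 * h1)%g (g2 * h2)%g.
Proof. by apply/permP=> -[u|u]; rewrite !permM !permE /= permM. Qed.

Definition glue_rot := sum_perm r1 r2.
Definition glue_rev_off := sum_perm (aug_rev K1 C) (aug_rev K2 C).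
Definition glue_face_off := sum_perm f1 f2.

Definition bridge_fun (t : T) : T := match t with
  | inl (inr c) => inr (inr c) | inr (inr c) => inl (inr c) | _ => t end.

Lemma bridge_invol : involutive bridge_fun.
Proof. by case=> [[]|[]]. Qed.

(** As for the cut above, the reversal of the glued map is [bridge_rev] times the
reversal [glue_rev_off] that leaves the bridges cut in half. *)
Definition bridge_rev : {perm T} := perm (inv_inj bridge_invol).

Definition bridge : {pred T} := [pred t | match t with
  | inl u => is_mark u | inr u => is_mark u end].

Definition glue_rev := (bridge_rev * glue_rev_off)%g.

Lemma glue_revE t : glue_rev t = match t with
  | inl (inl d) => inl (inl (dart_rev d)) | inr (inl d) => inr (inl (dart_rev d))
  | inl (inr c) => inr (inr c) | inr (inr c) => inl (inr c) end.
Proof. by rewrite permM !permE; case: t => [[d|c]|[d|c]] //=; rewrite permE. Qed.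

Lemma glue_revK : involutive glue_rev.
Proof.
by move=> t; rewrite !glue_revE; case: t => [[d|c]|[d|c]] //=; rewrite dart_revK.
Qed.

Lemma glue_rev_neq t : glue_rev t != t.
Proof.
rewrite glue_revE; case: t => [[d|c]|[d|c]] //=; apply/eqP=> -[] /eqP;
  by rewrite (negPf (dart_rev_neq d)).
Qed.

Let f := (glue_rev * glue_rot)%g.

Let fE : f = (bridge_rev * glue_face_off)%g.
Proof. by rewrite /f /glue_rev -mulgA /glue_rev_off /glue_rot sum_permM. Qed.

Let cut_next := skip glue_face_off (enum [predC bridge]).

Lemma orbit_sum_inl (g1 : {perm U1}) (g2 : {perm U2}) u :
  orbit (sum_perm g1 g2) (inl u) = map inl (orbit g1 u).
Proof.
rewrite (@orbit_map _ _ inl _ (sum_perm g1 g2)) //; try exact: perm_inj.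
  by move=> ? ? [].
by move=> v; rewrite [RHS]permE.
Qed.

Lemma orbit_sum_inr (g1 : {perm U1}) (g2 : {perm U2}) u :
  orbit (sum_perm g1 g2) (inr u) = map inr (orbit g2 u).
Proof.
rewrite (@orbit_map _ _ inr _ (sum_perm g1 g2)) //; try exact: perm_inj.
  by move=> ? ? [].
by move=> v; rewrite [RHS]permE.
Qed.

Lemma not_enum t : t \in bridge -> t \notin enum [predC bridge].
Proof. by move=> tB; rewrite mem_enum; apply/negPn. Qed.

Lemma filter_enum (s : seq T) :
  [seq t <- s | t \notin enum [predC bridge]] = filter bridge s.
Proof. by apply: eq_filter => t; rewrite mem_enum; apply: negbK. Qed.

Lemma cut_next_inl c : cut_next (inl (inr c)) = inl (inr (next l c)).
Proof.
have [_ o1 _] := aug1; have [j oE] := o1 c; rewrite -/f1 in oE.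
rewrite perm_next orbit_skip ?not_enum // filter_enum orbit_sum_inl filter_map.
rewrite -[filter _ _]/(filter (@is_mark K1 C) _) oE.
rewrite next_map ?map_inj_uniq ?rot_uniq //; try by move=> ? ? [].
rewrite next_map ?rot_uniq //; try by move=> ? ? [].
by rewrite next_rot.
Qed.

Lemma cut_next_inr c : cut_next (inr (inr c)) = inr (inr (prev l c)).
Proof.
have [_ o2 _] := aug2; have [j oE] := o2 c; rewrite -/f2 in oE.
rewrite perm_next orbit_skip ?not_enum // filter_enum orbit_sum_inr filter_map.
rewrite -[filter _ _]/(filter (@is_mark K2 C) _) oE.
rewrite next_map ?map_inj_uniq ?rot_uniq ?rev_uniq //; try by move=> ? ? [].
rewrite next_map ?rot_uniq ?rev_uniq //; try by move=> ? ? [].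
by rewrite !next_rot ?rot_uniq ?rev_uniq // next_rev.
Qed.

(** A face that leaves along the bridge [c] meets on the other side the predecessor
of [c] in [l] next, and after crossing back the successor of this one, which
is [c]. *)
Lemma bridge_faces c c' : fconnect f (inl (inr c)) (inl (inr c')) -> c = c'.
Proof.
rewrite -(@fconnect_skip _ f (enum [predC bridge])) ?not_enum //.
have -> : skip f (enum [predC bridge]) = (bridge_rev * cut_next)%g.
  rewrite fE skip_mul // => t; rewrite mem_enum permE.
  by case: t => [[d|c1]|[d|c1]].
have cyc : fcycle (bridge_rev * cut_next)%g [:: inl (inr c); inr (inr (prev l c))].
  rewrite /= !permM !permE /= cut_next_inl cut_next_inr eqxx /=.
  by rewrite next_prev // !eqxx.
by rewrite (fconnect_cycle cyc) ?mem_head // !inE orbF => /eqP [].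
Qed.

Let X1 : {pred U1} := [pred u | [forall c, ~~ fconnect f1 u (inr c)]].
Let X2 : {pred U2} := [pred u | [forall c, ~~ fconnect f2 u (inr c)]].

Let Y1 : {pred T} := [pred t | if t is inl u then u \in X1 else false].
Let Y2 : {pred T} := [pred t | if t is inr u then u \in X2 else false].

Let symf := fconnect_sym (@perm_inj _ f).

Let f_X1 u : u \in X1 -> f (inl u) = inl (f1 u) /\ f1 u \in X1.
Proof.
move=> uX; split.
  rewrite fE permM [bridge_rev _]permE; case: u uX => [d _|c]; first by rewrite permE.
  by move=> /forallP/(_ c); rewrite connect0.
move: uX; rewrite !inE => /forallP uX; apply/forallP=> c.
by rewrite -(same_fconnect1 (@perm_inj _ f1)).
Qed.

Let f_X2 u : u \in X2 -> f (inr u) = inr (f2 u) /\ f2 u \in X2.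
Proof.
move=> uX; split.
  rewrite fE permM [bridge_rev _]permE; case: u uX => [d _|c]; first by rewrite permE.
  by move=> /forallP/(_ c); rewrite connect0.
move: uX; rewrite !inE => /forallP uX; apply/forallP=> c.
by rewrite -(same_fconnect1 (@perm_inj _ f2)).
Qed.

Let clY1 : fclosed f Y1.
Proof.
apply: (intro_closed symf) => -[u|u] y // /eqP <- uX.
by have [-> ?] := f_X1 uX.
Qed.

Let clY2 : fclosed f Y2.
Proof.
apply: (intro_closed symf) => -[u|u] y // /eqP <- uX.
by have [-> ?] := f_X2 uX.
Qed.

(** The inner faces of both copies survive. *)
Lemma fcard_glue_face_ge : fcard f1 X1 + fcard f2 X2 + #|C| <= fcard f TF.
Proof.
have E1 : fcard f Y1 = fcard f1 X1.
  rewrite (@fcard_preim _ _ inl _ f1) //.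
  - by move=> ? ? [].
  - exact: perm_inj.
  - by case=> [u|u] // _; apply: codom_f.
  by move=> u /f_X1[].
have E2 : fcard f Y2 = fcard f2 X2.
  rewrite (@fcard_preim _ _ inr _ f2) //.
  - by move=> ? ? [].
  - exact: perm_inj.
  - by case=> [u|u] // _; apply: codom_f.
  by move=> u /f_X2[].
pose rest : {pred T} := [predD [predC Y1] & Y2].
have E3 : fcard f [predC Y1] = fcard f Y2 + fcard f rest.
  rewrite (@n_compID _ _ [predC Y1] Y2); congr (_ + _); apply: eq_n_comp_r.
  by case=> u; rewrite !inE ?andbF.
have E4 : #|C| <= fcard f rest.
  have inj_b : injective (fun c : C => inl (inr c) : T) by move=> c c' [].
  rewrite -(card_codom inj_b); apply: (n_comp_ge_indep symf).
  - by move=> x y xy; exact: (congr2 (fun b1 b2 => ~~ b2 && ~~ b1) (clY1 xy) (clY2 xy)).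
  - move=> _ /codomP[c ->]; rewrite !inE /=; apply/negP=> /forallP/(_ c).
    by rewrite connect0.
  by move=> _ _ /codomP[c ->] /codomP[c' ->] /bridge_faces ->.
by rewrite (n_compC Y1) E3 E1 E2 -!addnA !leq_add2l.
Qed.

Lemma glue_rot_source t t' : fconnect glue_rot t t' = (glue_source t == glue_source t').
Proof.
have [s1 _ _] := aug1; have [s2 _ _] := aug2.
rewrite fconnect_orbit; case: t => u; rewrite ?orbit_sum_inl ?orbit_sum_inr.
  case: t' => u'; last by apply/mapP=> -[].
  by rewrite mem_map; [rewrite -fconnect_orbit s1|move=> ? ? []].
case: t' => u'; first by apply/mapP=> -[].
by rewrite mem_map; [rewrite -fconnect_orbit s2|move=> ? ? []].
Qed.

Lemma aug_source_sur (K : graph) (iota : C -> K) : (forall x y : K, connect adj x y) ->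
  forall x : K, exists u : dart K + C, aug_source iota u = x.
Proof.
move=> conn x; have /connectP[[|z p] /=] := conn x (iota c0).
  by move=> _ xE; exists (inr c0).
by case/andP=> /dart_of[d dx _] _ _; exists (inl d).
Qed.

Lemma fcard_glue_rot : fcard glue_rot TF = #|K1| + #|K2|.
Proof.
rewrite -card_sum; apply: (fcard_src glue_rot_source) => -[x|x].
  by have [u <-] := aug_source_sur in1 conn_1 x; exists (inl u).
by have [u <-] := aug_source_sur in2 conn_2 x; exists (inr u).
Qed.

Lemma fcard_glue_rev : fcard glue_rev TF * 2 = #|TF|.
Proof.
apply: fcard_order_set => //; first exact: perm_inj.
apply/subsetP=> t _; rewrite inE; apply/eqP.
have cyc : fcycle glue_rev [:: t; glue_rev t] by rewrite /= glue_revK !eqxx.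
by rewrite (order_cycle cyc) ?mem_head //= inE eq_sym glue_rev_neq.
Qed.

Lemma glue_rev_adj t : adj (glue_source t) (glue_source (glue_rev t)).
Proof. by rewrite glue_revE; case: t => [[d|c]|[d|c]];
  [exact: (dart_adj d) | exact: eqxx | exact: (dart_adj d) | exact: eqxx]. Qed.

Lemma glue_rev_inj t t' : glue_source t = glue_source t' ->
  glue_source (glue_rev t) = glue_source (glue_rev t') -> t = t'.
Proof.
rewrite !glue_revE; case: t => [[d|c]|[d|c]]; case: t' => [[d'|c']|[d'|c']] //=.
- by case=> E [E']; rewrite (@dart_eq K1 d d' E E').
- by move=> _ [E]; rewrite (val_inj E).
- by case=> E [E']; rewrite (@dart_eq K2 d d' E E').
by move=> _ [E]; rewrite (val_inj E).
Qed.

Lemma glue_rev_sur x y : adj x y ->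
  exists2 t, glue_source t = x & glue_source (glue_rev t) = y.
Proof.
case: x y => [x|x] [y|y].
- by case/(@dart_of K1)=> d <- <-; exists (inl (inl d)); rewrite ?glue_revE.
- move=> /eqP E; have xC : (val x \in sv G1) && (val x \in sv G2).
    by rewrite (valP x) E (valP y).
  exists (inl (inr (exist _ (val x) xC))); rewrite ?glue_revE /=.
    by congr inl; apply: val_inj.
  by congr inr; apply: val_inj.
- move=> /eqP E; have xC : (val y \in sv G1) && (val y \in sv G2).
    by rewrite (valP y) E (valP x).
  exists (inr (inr (exist _ (val y) xC))); rewrite ?glue_revE /=.
    by congr inr; apply: val_inj.
  by congr inl; apply: val_inj.
by case/(@dart_of K2)=> d <- <-; exists (inr (inl d)); rewrite ?glue_revE.
Qed.

(** The lower bound on the number of faces meets the upper bound of Euler's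
inequality. *)
Lemma glue_genus0 : genus0 glue_rev glue_rot.
Proof.
have le := euler_le glue_rev glue_rot; rewrite /genus0; apply/eqP; rewrite eqn_leq le /=.
have O : n_comp (glink glue_rev glue_rot) TF <= 1.
  pose t0 : T := inl (inr c0); rewrite -(cards1 t0).
  apply: (n_comp_le_cover (glink_sym _ _)) => // t _; exists t0; rewrite ?inE //.
  apply: (connect_darts _ glue_rev_sur (conn_H _ _)) => u v E.
  by rewrite glue_rot_source E.
have {O} : euler_bound glue_rev glue_rot <= #|TF| + 2 * 1 by rewrite leq_add2l leq_mul2l O.
move/leq_trans; apply.
have [_ _ e1] := aug1; have [_ _ e2] := aug2.
have c : #|TF| = #|dart K1| + #|C| + (#|dart K2| + #|C|) by rewrite !card_sum.
have FT := fcard_glue_rev; have F := fcard_glue_face_ge.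
rewrite /euler_count fcard_glue_rot -/f; move: FT F c e1 e2.
rewrite !card_dart -/f1 -/f2 -/X1 -/X2.
move: (fcard glue_rev TF) (fcard f TF) (fcard f1 X1) (fcard f2 X2).
move: (fcard (@dart_rev K1) _) (fcard (@dart_rev K2) _) #|K1| #|K2| #|C| #|TF|.
by lia.
Qed.

Lemma glue_planar : planar H.
Proof.
exact: planar_darts glue_revK glue_rev_adj glue_rev_inj glue_rev_sur
  glue_rot_source glue_genus0.
Qed.

End Glue.

(** * Planar partial cubes and expansions *)

Lemma subseq_map_inj (A B : eqType) (v : A -> B) s t :
  injective v -> subseq (map v s) (map v t) -> subseq s t.
Proof.
move=> inj_v /subseqP[m sz E]; apply/subseqP; exists m.
  by rewrite size_map in sz.
by apply: (inj_map inj_v); rewrite E map_mask.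
Qed.

Lemma noncrossing_planar (G : graph) (G1 G2 : subgraph G) :
    partial_cube G -> isometric G1 -> isometric G2 -> edge_cover G1 G2 ->
    sv G1 :&: sv G2 != set0 -> noncrossing G1 G2 ->
  planar (expansion_graph G1 G2).
Proof.
move=> pcG iso1 iso2 cov ne [E1 [E2 [s1 [s2 [o1 o2 [k s2E]]]]]].
have [U1 s1A [k1 sub1]] := o1; have [_ _ [k2 sub2]] := o2.
have [d [phi emb]] := proj1 (partial_cubeP _) (expansion_cube iso1 iso2 cov pcG).
have [x xA] := set0Pn _ ne; have xC : (x \in sv G1) && (x \in sv G2) by rewrite -in_setI.
pose c0 : common G1 G2 := exist _ x xC.
pose l : seq (common G1 G2) := pmap insub s1.
have lE : map val l = s1.
  rewrite (pmap_filter (insubK _)); apply/all_filterP/allP=> y.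
  by rewrite s1A in_setI => yA; rewrite /= isSome_insub.
have Ul : uniq l by rewrite -(map_inj_uniq val_inj) lE.
have lC c : c \in l by rewrite -(mem_map val_inj) lE s1A in_setI (valP c).
have e1 : [seq val x | x <- map (@in1 _ G1 G2) l] = s1 by rewrite -map_comp.
have e2 : [seq val x | x <- map (@in2 _ G1 G2) (rot k (rev l))] = s2.
  by rewrite -map_comp map_rot map_rev [map _ l]lE -s2E.
have l_outer1 : subseq (map (@in1 _ G1 G2) l) (rot k1 (pe_outer E1)).
  by apply: (subseq_map_inj val_inj); rewrite e1 map_rot.
have l_outer2 : subseq (map (@in2 _ G1 G2) (rot k (rev l))) (rot k2 (pe_outer E2)).
  by apply: (subseq_map_inj val_inj); rewrite e2 map_rot.
have [r1 a1] := augment (@in1_inj _ G1 G2) Ul lC l_outer1 c0.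
have Ul2 : uniq (rot k (rev l)) by rewrite rot_uniq rev_uniq.
have lC2 c : c \in rot k (rev l) by rewrite mem_rot mem_rev.
have [r2 a2] := augment (@in2_inj _ G1 G2) Ul2 lC2 l_outer2 c0.
exact: (glue_planar c0 Ul a1 a2 (emb_connect emb)
  (@pe_connected _ E1) (@pe_connected _ E2)).
Qed.

Lemma expansion_step (G H : graph) : partial_cube G ->
  noncrossing_2face_expansion G H -> planar H /\ partial_cube H.
Proof.
move=> pcG [_ [G1 [G2 [[iso1 iso2 cov ne isoH] nc]]]]; split.
  exact: planar_iso isoH (noncrossing_planar pcG iso1 iso2 cov ne nc).
exact: partial_cube_iso isoH (expansion_cube iso1 iso2 cov pcG).
Qed.

Lemma K1_partial_cube : partial_cube K1.
Proof.
apply/partial_cubeP; exists 0, (fun _ => [ffun=> false]); split=> // -[] [].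
rewrite (_ : hamming _ _ = 0); first exact: walk0.
by apply/eqP; rewrite hamming_eq0.
Qed.

Lemma single_vertex (H : graph) : #|H| = 1 -> iso H K1.
Proof.
move=> H1; have [x0 x0_only] := fintype1 H1.
exists (fun=> tt); split; first by exists (fun=> x0); [move=> x; rewrite x0_only|case].
by move=> x y; rewrite (x0_only x) (x0_only y) !adj_irr.
Qed.

(** The last graph of the sequence is [H] itself and not just isomorphic to it, so
that the induction does not need expansions to be invariant under
isomorphism. *)
Lemma expansion_sequence (H : graph) : planar H -> partial_cube H ->
  exists (l : nat) (Hs : nat -> graph), [/\ iso (Hs 0) K1, Hs l = H &
    forall i, i < l -> noncrossing_2face_expansion (Hs i) (Hs i.+1)].
Proof.
have [n] := ubnP #|H|; elim: n H => // n IHn H /ltnSE le_n [r [rot_r sph_r]].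
move=> /partial_cubeP[d [phi emb]].
have [H1|H1] := eqVneq #|H| 1.
  by exists 0, (fun=> H); split=> //; apply: single_vertex.
have gt1 : 1 < #|H| by rewrite ltn_neqAle eq_sym H1 vertex_gt0.
have /card_gt1P[u [v [_ _ uv]]] := gt1.
have [i0 ui0] : exists i, phi u i != phi v i.
  apply/existsP; apply: contraNT uv; rewrite negb_exists => /forallP E.
  by apply/eqP/(emb_inj emb)/ffunP => i; apply/eqP; have := E i; rewrite negbK.
have sides b : exists w, phi w i0 = b.
  have [<-|b0] := eqVneq (phi u i0) b; first by exists u.
  by exists v; move: ui0 b0; case: (phi u i0); case: (phi v i0); case: b.
have lt := card_contract emb sides.
have step := contract_expansion emb sides rot_r sph_r.
have [l [Hs [Hs0 Hsl Hstep]]] :=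
  IHn _ (leq_trans lt le_n) step.1 (contract_partial_cube emb sides).
exists l.+1, (fun i => if i <= l then Hs i else H); split=> //; first by rewrite ltnn.
move=> i /ltnSE il /=; rewrite il; case: ltngtP il => // [il|->] _.
  exact: Hstep.
by rewrite Hsl.
Qed.

Theorem theorem2 (H : graph) :
  (planar H /\ partial_cube H) <->
  (exists (l : nat) (Hs : nat -> graph),
     [/\ iso (Hs 0) K1, iso (Hs l) H &
         forall i : nat, i < l ->
           noncrossing_2face_expansion (Hs i) (Hs i.+1)]).
Proof.
split=> [[plH pcH]|[l [Hs [Hs0 HsH step]]]].
  have [l [Hs [Hs0 HsH step]]] := expansion_sequence plH pcH.
  by exists l, Hs; split=> //; rewrite HsH; apply: iso_refl.
have HK := iso_sym HsH.
suff [plHs pcHs] : planar (Hs l) /\ partial_cube (Hs l).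
  by split; [apply: planar_iso HK plHs | apply: partial_cube_iso HK pcHs].
elim: l step {HsH HK} => [_|l IHl step].
  split; last exact: partial_cube_iso Hs0 K1_partial_cube.
  apply: planar_iso Hs0 _; exists 1%g.
  have nodart (d : dart K1) : False by have := dart_adj d.
  have no_comp e : n_comp e (dart K1) = 0.
    by apply: eq_card0 => d; case: (nodart d).
  split; first by move=> d; case: (nodart d).
  by rewrite /spherical !no_comp.
have [_ pc] := IHl (fun i il => step i (ltnW il)).
exact: expansion_step pc (step l (ltnSn l)).
Qed.
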